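(* Let $p=1$ or $p\ge1.5$. Suppose that $(\mathbf X,\mathbf X')\in\mathbb H^d\times\mathbb H^d$ is a matrix Stein pair with conditional variance $\mathbf\Delta_{\mathbf X}$, where $\mathbb E\|\mathbf X\|_{2p}^{2p}<\infty$. Then $$\big(\mathbb E\|\mathbf X\|_{2p}^{2p}\big)^{1/(2p)}\le\sqrt{2p-1}\cdot\big(\mathbb E\|\mathbf\Delta_{\mathbf X}\|_p^p\big)^{1/(2p)}.$$
   Context: $\mathbb H^d$ is the space of $d\times d$ complex Hermitian matrices; $\|\cdot\|$ is the spectral norm. For $p\ge1$, the Schatten $p$-norm of a $d\times d$ complex matrix is $\|\mathbf B\|_p=(\mathrm{tr}\,|\mathbf B|^p)^{1/p}$ with $|\mathbf B|=(\mathbf B^*\mathbf B)^{1/2}$. Exchangeable pair: random variables $Z,Z'$ taking values in a Polish space $\mathcal Z$ form an exchangeable pair if $(Z,Z')$ and $(Z',Z)$ have the same distribution. Matrix Stein pair: let $(Z,Z')$ be an exchangeable pair in a Polish space $\mathcal Z$, let $\mathbf\Psi:\mathcal Z\to\mathbb H^d$ be measurable, and set $\mathbf X=\mathbf\Psi(Z)$, $\mathbf X'=\mathbf\Psi(Z')$. The pair $(\mathbf X,\mathbf X')$ is a matrix Stein pair with scale factor $\alpha\in(0,1]$ if $\mathbb E[\mathbf X-\mathbf X'\mid Z]=\alpha\mathbf X$ almost surely; it is always assumed that $\mathbb E\|\mathbf X\|^2<\infty$. Conditional variance: $\mathbf\Delta_{\mathbf X}=\frac1{2\alpha}\mathbb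 E[(\mathbf X-\mathbf X')^2\mid Z]$ (any version). *)

(* Defs.v *)
From HB Require Import structures.
From mathcomp Require Import all_boot all_order all_algebra.
From mathcomp Require Import all_classical all_reals all_analysis.
From mathcomp Require Import complex.

Set Implicit Arguments.
Unset Strict Implicit.
Unset Printing Implicit Defensive.

Import Order.TTheory GRing.Theory Num.Theory.
Import numFieldNormedType.Exports.

Local Open Scope classical_set_scope.
Local Open Scope complex_scope.
Local Open Scope sesquilinear_scope.
Local Open Scope ring_scope.

Section matrices.
Variables (R : realType) (d : nat).
Implicit Types A B : 'M[R[i]]_d.

(* Functional calculus: f is applied to the eigenvalues of A in a unitary
   diagonalization. It is meaningful only for Hermitian A, whose eigenvalues
   are real. *)
Definition mx_fun (f : R -> R) A : 'M[R[i]]_d :=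
  let U := spectralmx A in
  U^t* *m diag_mx (map_mx (fun z => (f (complex.Re z))%:C) (spectral_diag A))
    *m U.

Definition mx_abs B : 'M[R[i]]_d := mx_fun Num.sqrt (B^t* *m B).

Definition schatten_norm (p : R) B : R :=
  complex.Re (\tr (mx_fun (fun x => x `^ p) (mx_abs B))) `^ p^-1.

(* The largest singular value, i.e. the largest eigenvalue of |B|. *)
Definition spectral_norm B : R :=
  \big[Num.max/0]_(i < d) complex.Re (spectral_diag (mx_abs B) 0 i).

Definition measurable_mx d' (S : measurableType d') (F : S -> 'M[R[i]]_d) :=
  forall i j, measurable_fun setT (fun x => complex.Re (F x i j)) /\
              measurable_fun setT (fun x => complex.Im (F x i j)).

End matrices.

Definition polish (R : realType) (S : topologicalType) : Prop :=
  (exists2 Q : set S, countable Q & dense Q) /\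
  exists dist : S -> S -> R,
    [/\ forall x y, dist x y = 0 <-> x = y,
        forall x y, dist x y = dist y x,
        forall x y z, dist x z <= dist x y + dist y z,
        forall (x : S) (A : set S), nbhs x A <->
          exists2 e : R, 0 < e & [set y | dist x y < e] `<=` A &
        forall u : nat -> S,
          (forall e : R, 0 < e -> exists N : nat, forall m n : nat,
             (N <= m)%N -> (N <= n)%N -> dist (u m) (u n) < e) ->
          exists l : S, u @ \oo --> l].

Definition borel (S : ptopologicalType) := g_sigma_algebraType (@open S).

Section conditional_expectation.
Context d d' (T : measurableType d) (E : measurableType d') (R : realType).
Variables (P : probability T R) (Z : T -> E).

(* g is a version of E[Y | Z]; the first set of conditions on g expresses that
   it is measurable with respect to the sigma-algebra generated by Z. *)
Definition is_cond_exp (Y g : T -> R) : Prop :=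
  [/\ P.-integrable setT (EFin \o Y),
      P.-integrable setT (EFin \o g),
      forall B : set R, measurable B ->
        preimage_set_system setT Z measurable (g @^-1` B) &
      forall A : set E, measurable A ->
        (\int[P]_(w in Z @^-1` A) (g w)%:E =
         \int[P]_(w in Z @^-1` A) (Y w)%:E)%E].

Definition is_cond_exp_mx n (Y G : T -> 'M[R[i]]_n) : Prop :=
  forall i j,
    is_cond_exp (fun w => complex.Re (Y w i j)) (fun w => complex.Re (G w i j))
    /\
    is_cond_exp (fun w => complex.Im (Y w i j)) (fun w => complex.Im (G w i j)).

Definition exchangeable (Z' : T -> E) : Prop :=
  forall C : set (E * E), measurable C ->
    P ((fun w => (Z w, Z' w)) @^-1` C) = P ((fun w => (Z' w, Z w)) @^-1` C).

End conditional_expectation.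

Section stein_pair.
Context d (T : measurableType d) (R : realType) (S : ptopologicalType).
Variables (n : nat) (P : probability T R) (Z Z' : T -> borel S).
Variables (Psi : borel S -> 'M[R[i]]_n) (alpha : R).

Record matrix_stein_pair : Prop := {
  stein_measurable : measurable_fun setT Z /\ measurable_fun setT Z' ;
  stein_exchangeable : exchangeable P Z Z' ;
  stein_map_hermitian : forall z, Psi z \is hermsymmx ;
  stein_map_measurable : measurable_mx Psi ;
  stein_scale : 0 < alpha <= 1 ;
  stein_identity : exists2 W : T -> 'M[R[i]]_n,
    is_cond_exp_mx P Z (fun w => Psi (Z w) - Psi (Z' w)) W &
    {ae P, forall w, W w = alpha%:C *: Psi (Z w)} ;
  stein_square_integrable :
    ('E_P[fun w => (spectral_norm (Psi (Z w)) ^+ 2)%R] < +oo)%E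
}.

(* Delta is a version of the conditional variance. *)
Definition is_cond_variance (Delta : T -> 'M[R[i]]_n) : Prop :=
  exists2 W : T -> 'M[R[i]]_n,
    is_cond_exp_mx P Z
      (fun w => (Psi (Z w) - Psi (Z' w)) *m (Psi (Z w) - Psi (Z' w))) W &
    forall w, Delta w = ((2 * alpha)^-1)%:C *: W w.

End stein_pair.

(* Main.v *)
Require Import Defs.
From mathcomp Require Import all_boot all_order all_algebra.
From mathcomp Require Import all_classical all_reals all_analysis.
From mathcomp Require Import complex.
From mathcomp Require Import measurable_realfun ring lra.

(* With F(x) = x |x|^(2p-2) and G(x) = |x|^(2p-2), exchangeability and the
   Stein identity give
     2 alpha E ||X||_{2p}^{2p} = E tr (X - X') (F(X) - F(X')).
   The trace of a product f(A) g(B) is the sum of f(a_i) g(b_j) |<u_i, v_j>|^2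
   over eigenpairs of A and B, so scalar inequalities pass to traces. The
   Hermite-Hadamard inequality for the convex function (2p-1) |x|^(2p-2) bounds
   the right-hand side by (2p-1) E tr (X - X')^2 G(X)
   = 2 alpha (2p-1) E tr Delta G(X). Young's inequality, with the factor 2p-1
   put on Delta, turns this into
     E ||X||^{2p} <= (2p-1)^p / p E ||Delta||^p + (1 - 1/p) E ||X||^{2p},
   and the last term is absorbed since it is finite.
   The entries of f(X) are measurable for every Borel f: Borel functions are
   generated from the identity by sums, products and pointwise limits. *)

Set Implicit Arguments.
Unset Strict Implicit.
Unset Printing Implicit Defensive.

Import Order.TTheory GRing.Theory Num.Theory.
Import numFieldNormedType.Exports.

Local Open Scope classical_set_scope.
Local Open Scope complex_scope.
Local Open Scope sesquilinear_scope.
Local Open Scope ring_scope.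

(** * Functional calculus of Hermitian matrices *)

(** Put s = 2p - 1, so that F(x) = x |x|^(s-1) and G(x) = |x|^(s-1). The condition on p says s = 1
    or s >= 2: then G is constant or a power of |x| with exponent at least 1, hence convex. Two
    obstacles shape the development. The unitary matrix of a diagonalization is an arbitrary choice,
    with no control on how it depends on the matrix, so measurability of f(X) is obtained by varying
    f instead of following the eigenvectors. And conditional expectations are given entry by entry,
    so each trace identity requires an integrable majorant for the products of entries; entries are
    bounded by Schatten norms, and the degrees in X and X' add up to 2p. The moment of Delta may be
    infinite, in which case the right-hand side is +oo. *)

Section unitary_diagonalization.
Variables (C : numClosedFieldType) (d : nat).
Implicit Types (A B U V : 'M[C]_d) (D E : 'rV[C]_d) (F G : C -> C).

(** For unitary [U], the rows of [U] are the conjugate transposes of the eigenvectors, with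
    eigenvalues [D]. *)
Definition udiag U D : 'M[C]_d := U^t* *m diag_mx D *m U.

Definition fcalc F A := udiag (spectralmx A) (map_mx F (spectral_diag A)).

(** These are the squared moduli of the entries of a unitary matrix, hence a doubly stochastic
    array: a double sum weighted by it collapses to a trace when the summand depends on one index
    only. *)
Definition overlapC A B i j : C :=
  `|(spectralmx A *m (spectralmx B)^t*) i j| ^+ 2.

Lemma hermsymmxP A : reflect (A^t* = A) (A \is hermsymmx).
Proof.
apply: (iffP (is_hermitianmxP _ _ _)); rewrite expr0 scale1r => AE.
  by rewrite [RHS]AE.
by rewrite AE.
Qed.

Lemma hermsymmxB A B :
  A \is hermsymmx -> B \is hermsymmx -> A - B \is hermsymmx.
Proof.
move=> /hermsymmxP hA /hermsymmxP hB; apply/hermsymmxP.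
by rewrite linearB map_mxB /= hA hB.
Qed.

Lemma udiag_adj U D : (udiag U D)^t* = udiag U (map_mx Num.conj D).
Proof.
by rewrite /udiag !trmx_mul !map_mxM !mulmxA trmxCK tr_diag_mx map_diag_mx.
Qed.

Lemma udiagM U D E : U \is unitarymx ->
  udiag U D *m udiag U E = udiag U (\row_k (D 0 k * E 0 k)).
Proof.
move=> hU; rewrite /udiag !mulmxA mulmxtVK //.
by rewrite -[U^t* *m _ *m _]mulmxA mulmx_diag.
Qed.

Lemma udiag_normal U D : U \is unitarymx -> udiag U D \is normalmx.
Proof.
move=> hU; apply/normalmxP; rewrite udiag_adj !udiagM //; congr udiag.
by apply/rowP => k; rewrite !mxE mulrC.
Qed.

Lemma fcalc_adj F A : (forall z, Num.conj (F z) = F z) -> (fcalc F A)^t* = fcalc F A.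
Proof.
by move=> hF; rewrite /fcalc udiag_adj; congr udiag; apply/rowP => k; rewrite !mxE hF.
Qed.

Lemma normal_udiag A : A \is normalmx -> A = udiag (spectralmx A) (spectral_diag A).
Proof.
move/orthomx_spectralP; rewrite invmx_unitary ?spectral_unitarymx //.
Qed.

Lemma unitarymx_tmul U : U \is unitarymx -> U^t* *m U = 1%:M.
Proof. by move=> hU; rewrite -invmx_unitary // mulVmx // unitarymx_unit. Qed.

(* Two unitary diagonalizations [U], [V] of a matrix are intertwined by
   [V U^*], which can only link equal eigenvalues. *)
Lemma fcalc_udiag F U D : U \is unitarymx ->
  fcalc F (udiag U D) = udiag U (map_mx F D).
Proof.
move=> hU; rewrite /fcalc; move: (normal_udiag (udiag_normal D hU)).
move: (spectralmx _) (spectral_unitarymx (udiag U D)) (spectral_diag _) => V hV E.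
move=> AE.
have h1 : diag_mx E *m (V *m U^t*) = (V *m U^t*) *m diag_mx D.
  have : V *m udiag U D *m U^t* = V *m udiag V E *m U^t* by rewrite AE.
  by rewrite /udiag !mulmxA (unitarymxP hV) mul1mx mulmxtVK.
have h2 : diag_mx (map_mx F E) *m (V *m U^t*) = (V *m U^t*) *m diag_mx (map_mx F D).
  move: h1; move: (V *m U^t*) => W /matrixP h1.
  apply/matrixP => i j; move: (h1 i j); rewrite !mul_diag_mx !mul_mx_diag !mxE.
  have [->|z0] := eqVneq (W i j) 0; first by rewrite !mulr0 !mul0r.
  by rewrite mulrC => /(mulfI z0) ->; exact: mulrC.
rewrite /udiag.
have -> : V^t* *m diag_mx (map_mx F E) *m V =
    V^t* *m (diag_mx (map_mx F E) *m (V *m U^t*)) *m U.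
  by rewrite !mulmxA -[RHS]mulmxA unitarymx_tmul // mulmx1.
by rewrite h2 !mulmxA unitarymx_tmul // mul1mx.
Qed.

Lemma fcalc_id A : A \is normalmx -> fcalc id A = A.
Proof. by move=> hA; rewrite /fcalc map_mx_id // -normal_udiag. Qed.

Lemma fcalc_comp F G A : fcalc F (fcalc G A) = fcalc (F \o G) A.
Proof.
rewrite {2}/fcalc fcalc_udiag ?spectral_unitarymx // /fcalc; congr udiag.
by rewrite -map_mx_comp.
Qed.

Lemma fcalcM F G A : fcalc F A *m fcalc G A = fcalc (fun x => F x * G x) A.
Proof.
rewrite /fcalc udiagM ?spectral_unitarymx //; congr udiag.
by apply/rowP => k; rewrite !mxE.
Qed.

Lemma eq_fcalc F G A : (forall k, F (spectral_diag A 0 k) = G (spectral_diag A 0 k)) ->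
  fcalc F A = fcalc G A.
Proof. by move=> FG; congr udiag; apply/rowP => k; rewrite !mxE. Qed.

Lemma fcalcE F A i j : fcalc F A i j =
  \sum_k F (spectral_diag A 0 k) * ((spectralmx A k i)^* * spectralmx A k j).
Proof.
rewrite /fcalc /udiag mul_mx_diag mxE; apply: eq_bigr => k _.
by rewrite !mxE mulrAC mulrC.
Qed.

Lemma fcalcD F G A : fcalc (fun x => F x + G x) A = fcalc F A + fcalc G A.
Proof.
apply/matrixP => i j; rewrite [RHS]mxE !fcalcE -big_split; apply: eq_bigr => k _ /=.
by rewrite mulrDl.
Qed.

Lemma fcalc_cst c A : fcalc (fun=> c) A = c *: 1%:M.
Proof.
apply/matrixP => i j; have := unitarymx_tmul (spectral_unitarymx A).
move=> /matrixP/(_ i j) e; rewrite fcalcE [RHS]mxE -e.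
by rewrite mxE mulr_sumr; apply: eq_bigr => k _; rewrite !mxE.
Qed.

Lemma tr_fcalc F A : \tr (fcalc F A) = \sum_k F (spectral_diag A 0 k).
Proof.
rewrite /fcalc /udiag mxtrace_mulC mulmxA (unitarymxP (spectral_unitarymx A)).
by rewrite mul1mx mxtrace_diag; apply: eq_bigr => k _; rewrite mxE.
Qed.

(** By cyclicity the trace is that of a W b W^*, where a and b are diagonal and W = U V^* links the
    two eigenbases. *)
Lemma tr_fcalc2 F G A B : \tr (fcalc F A *m fcalc G B) =
  \sum_i \sum_j F (spectral_diag A 0 i) * G (spectral_diag B 0 j) * overlapC A B i j.
Proof.
rewrite /fcalc /udiag -!mulmxA mxtrace_mulC /overlapC.
move: (spectralmx A) (spectralmx B) => U V.
set a := map_mx F _; set b := map_mx G _.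
have -> : diag_mx a *m (U *m (V^t* *m (diag_mx b *m V))) *m U^t* =
   (diag_mx a *m (U *m V^t*)) *m (diag_mx b *m (U *m V^t*)^t*).
  by rewrite trmx_mul map_mxM trmxCK !mulmxA.
move: (U *m V^t*) => W.
rewrite /mxtrace; apply: eq_bigr => i _.
rewrite mxE; apply: eq_bigr => j _.
by rewrite mul_diag_mx mul_diag_mx !mxE normCK; ring.
Qed.

Lemma unitarymx_row_norm V i : V \is unitarymx -> \sum_j `|V i j| ^+ 2 = 1.
Proof.
move=> /unitarymxP/matrixP/(_ i i); rewrite !mxE eqxx mulr1n => <-.
by apply: eq_bigr => j _; rewrite !mxE normCK.
Qed.

Lemma unitarymx_le1 V i j : V \is unitarymx -> `|V i j| <= 1.
Proof.
move=> hV; rewrite -(@ler_pXn2r _ 2) ?nnegrE // expr1n -(unitarymx_row_norm i hV).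
by rewrite (bigD1 j) //= lerDl sumr_ge0 // => k _; rewrite exprn_ge0.
Qed.

Lemma sum_overlapC_r A B i : \sum_j overlapC A B i j = 1.
Proof.
by apply: unitarymx_row_norm; rewrite mul_unitarymx ?trmxC_unitary ?spectral_unitarymx.
Qed.

Lemma overlapC_sym A B i j : overlapC A B i j = overlapC B A j i.
Proof.
rewrite /overlapC.
have -> : spectralmx A *m (spectralmx B)^t* = (spectralmx B *m (spectralmx A)^t*)^t*.
  by rewrite trmx_mul map_mxM trmxCK.
by rewrite !mxE norm_conjC.
Qed.

(** Entries of a unitary matrix have modulus at most 1. The crude factor [d] is harmless, since
    these bounds serve only to establish integrability. *)
Lemma fcalc_entry_le F A (M : C) i j : 
  (forall k, `|F (spectral_diag A 0 k)| <= M) ->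
  `|fcalc F A i j| <= M *+ d.
Proof.
move=> FM; rewrite fcalcE (le_trans (ler_norm_sum _ _ _)) //.
rewrite -[X in _ <= _ *+ X]card_ord -sumr_const ler_sum // => k _.
have M0 : 0 <= M := le_trans (normr_ge0 _) (FM k).
rewrite !normrM -[M]mulr1 ler_pM ?mulr_ge0 //.
by rewrite norm_conjC mulr_ile1 // unitarymx_le1 ?spectral_unitarymx.
Qed.

End unitary_diagonalization.

Section traces.
Variables (C : numClosedFieldType) (d : nat).
Implicit Types (A B F G : 'M[C]_d).

Lemma mxtraceB A B : \tr (A - B) = \tr A - \tr B.
Proof. exact: raddfB. Qed.

(** With [F] a function of [A] and [G] a function of [B], every mixed term has its [A] factor on the
    left, the shape in which the eigenpair formula applies. *)
Lemma tr_mulBB A B F G : \tr ((A - B) *m (F - G)) =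
  \tr (A *m F) - \tr (A *m G) - \tr (F *m B) + \tr (B *m G).
Proof.
rewrite mulmxBl !mulmxBr !mxtraceB [\tr (B *m F)]mxtrace_mulC; ring.
Qed.

(** The two terms are one function of a pair and its value at the swapped pair, so exchangeability
    will give them equal expectations. *)
Lemma tr_mulBB_split A B F G :
  \tr ((A - B) *m (F - G)) = \tr ((A - B) *m F) + \tr ((B - A) *m G).
Proof. by rewrite mulmxBr mxtraceB -[B - A]opprB mulNmx [\tr (- _)]raddfN. Qed.

Lemma tr_sqrB_mul A B F : \tr ((A - B) *m (A - B) *m F) =
  \tr (A *m A *m F) - \tr (F *m A *m B) - \tr (A *m F *m B) + \tr (F *m (B *m B)).
Proof.
rewrite mulmxBl !mulmxBr 3!mulmxBl !mxtraceB.
rewrite [\tr (A *m B *m F)]mxtrace_mulC [\tr (B *m B *m F)]mxtrace_mulC.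
by rewrite -[B *m A *m F]mulmxA [\tr (B *m (A *m F))]mxtrace_mulC !mulmxA; ring.
Qed.

End traces.

(** * Traces of functions of Hermitian matrices as sums over pairs of eigenvalues *)

Section real_functional_calculus.
Variables (R : realType) (d : nat).
Implicit Types (A B : 'M[R[i]]_d) (f g : R -> R).

Definition cfun f (z : R[i]) : R[i] := (f (complex.Re z))%:C.

Definition eigv A (k : 'I_d) : R := complex.Re (spectral_diag A 0 k).

Lemma cReD (x y : R[i]) : complex.Re (x + y) = complex.Re x + complex.Re y.
Proof. by case: x; case: y. Qed.

Lemma cReN (x : R[i]) : complex.Re (- x) = - complex.Re x.
Proof. by case: x. Qed.

Lemma cReM (x y : R[i]) : complex.Re (x * y) =
  complex.Re x * complex.Re y - complex.Im x * complex.Im y.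
Proof. by case: x; case: y. Qed.

Lemma cImD (x y : R[i]) : complex.Im (x + y) = complex.Im x + complex.Im y.
Proof. by case: x; case: y. Qed.

Lemma cImN (x : R[i]) : complex.Im (- x) = - complex.Im x.
Proof. by case: x. Qed.

Lemma cImM (x y : R[i]) : complex.Im (x * y) =
  complex.Re x * complex.Im y + complex.Im x * complex.Re y.
Proof. by case: x; case: y. Qed.

Lemma Re_sum I (r : seq I) (F : I -> R[i]) :
  complex.Re (\sum_(i <- r) F i) = \sum_(i <- r) complex.Re (F i).
Proof. by elim/big_ind2: _ => // ? ? ? ? <- <-; rewrite cReD. Qed.

Lemma Im_sum I (r : seq I) (F : I -> R[i]) :
  complex.Im (\sum_(i <- r) F i) = \sum_(i <- r) complex.Im (F i).
Proof. by elim/big_ind2: _ => // ? ? ? ? <- <-; rewrite cImD. Qed.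

Lemma cRe_conj (x : R[i]) : complex.Re (Num.conj x) = complex.Re x.
Proof. by case: x. Qed.

Lemma cIm_conj (x : R[i]) : complex.Im (Num.conj x) = - complex.Im x.
Proof. by case: x. Qed.

Lemma conj_real (x : R) : Num.conj (x%:C : R[i]) = x%:C.
Proof. by apply/CrealP; rewrite complex_real. Qed.

Lemma conj_cfun f z : Num.conj (cfun f z) = cfun f z.
Proof. exact: conj_real. Qed.

Lemma mx_funE f A : mx_fun f A = fcalc (cfun f) A.
Proof. by []. Qed.

Local Opaque mx_fun.

Lemma mx_fun_adj f A : (mx_fun f A)^t* = mx_fun f A.
Proof. by rewrite mx_funE (fcalc_adj _ (@conj_cfun f)). Qed.

Lemma mx_fun_herm f A : mx_fun f A \is hermsymmx.
Proof. exact/hermsymmxP/mx_fun_adj. Qed.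

Lemma mx_fun_id A : A \is hermsymmx -> mx_fun id A = A.
Proof.
move=> hA; rewrite mx_funE -[RHS](fcalc_id (hermitian_normalmx hA)).
apply: eq_fcalc => k; rewrite /cfun RRe_real //.
by move: (hermitian_spectral_diag_real hA) => /mxOverP; exact.
Qed.

Lemma mx_fun_comp f g A : mx_fun f (mx_fun g A) = mx_fun (f \o g) A.
Proof. by rewrite !mx_funE fcalc_comp. Qed.

Lemma mx_funM f g A : mx_fun f A *m mx_fun g A = mx_fun (fun x => f x * g x) A.
Proof.
by rewrite !mx_funE fcalcM; apply: eq_fcalc => k; rewrite /cfun -rmorphM.
Qed.

Lemma mx_fun_cst c A : mx_fun (fun=> c) A = c%:C *: 1%:M.
Proof. by rewrite mx_funE -(fcalc_cst c%:C A). Qed.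

Lemma mx_funD f g A : mx_fun (fun x => f x + g x) A = mx_fun f A + mx_fun g A.
Proof.
by rewrite !mx_funE -fcalcD; apply: eq_fcalc => k; rewrite /cfun -rmorphD.
Qed.

Lemma adj_mul_herm A : A^t* *m A \is hermsymmx.
Proof. by apply/hermsymmxP; rewrite trmx_mul map_mxM trmxCK. Qed.

Lemma mx_abs_herm A : A \is hermsymmx -> mx_abs A = mx_fun Num.norm A.
Proof.
move=> hA; rewrite /mx_abs; move: (hermsymmxP _ hA) => ->.
rewrite -{1 2}(mx_fun_id hA) mx_funM mx_fun_comp.
by congr mx_fun; apply/funext => x /=; rewrite -expr2 sqrtr_sqr.
Qed.

Lemma Re_tr_mx_fun f A : complex.Re (\tr (mx_fun f A)) = \sum_k f (eigv A k).
Proof. by rewrite mx_funE tr_fcalc Re_sum. Qed.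

Lemma Re_real_mul (x : R) (z : R[i]) : complex.Re (x%:C * z) = x * complex.Re z.
Proof. by rewrite cReM /= mul0r subr0. Qed.

Lemma Im_real_mul (x : R) (z : R[i]) : complex.Im (x%:C * z) = x * complex.Im z.
Proof. by rewrite cImM /= mul0r addr0. Qed.

Lemma Re_mx_fun f A i j : complex.Re (mx_fun f A i j) =
  \sum_k f (eigv A k) * complex.Re ((spectralmx A k i)^* * spectralmx A k j).
Proof.
rewrite mx_funE fcalcE Re_sum; apply: eq_bigr => k _.
exact: Re_real_mul.
Qed.

Lemma Im_mx_fun f A i j : complex.Im (mx_fun f A i j) =
  \sum_k f (eigv A k) * complex.Im ((spectralmx A k i)^* * spectralmx A k j).
Proof.
rewrite mx_funE fcalcE Im_sum; apply: eq_bigr => k _.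
exact: Im_real_mul.
Qed.

Lemma mx_fun_entry_le f A (M : R) i j : (forall k, `|f (eigv A k)| <= M) ->
  `|mx_fun f A i j| <= (M *+ d)%:C.
Proof.
move=> fM; rewrite mx_funE rmorphMn; apply: fcalc_entry_le => k.
rewrite normc_def -[leRHS]/(M%:C) lecR /= expr0n addr0 sqrtr_sqr; exact: fM.
Qed.

Definition overlap A B i j : R := complex.Re (overlapC A B i j).

Lemma overlapE A B i j : (overlap A B i j)%:C = overlapC A B i j.
Proof. by rewrite /overlap RRe_real // ger0_real // exprn_ge0. Qed.

Lemma overlap_ge0 A B i j : 0 <= overlap A B i j.
Proof. by rewrite -lecR overlapE exprn_ge0. Qed.

Lemma sum_overlap_r A B i : \sum_j overlap A B i j = 1.
Proof. by have := congr1 (@complex.Re R) (sum_overlapC_r A B i); rewrite Re_sum. Qed.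

Lemma sum_overlap_l A B j : \sum_i overlap A B i j = 1.
Proof.
rewrite -(sum_overlap_r B A j); apply: eq_bigr => i _.
by rewrite /overlap overlapC_sym.
Qed.

(** The integral of [h] against the positive measure with mass |<u_i, v_j>|^2 at the point (a_i,
    b_j); its marginals are the counting measures of the two spectra. *)
Definition dsum A B (h : R -> R -> R) : R :=
  \sum_i \sum_j h (eigv A i) (eigv B j) * overlap A B i j.

Lemma dsumD A B h1 h2 : dsum A B h1 + dsum A B h2 = dsum A B (fun a b => h1 a b + h2 a b).
Proof.
rewrite /dsum -big_split; apply: eq_bigr => i _ /=.
by rewrite -big_split; apply: eq_bigr => j _ /=; rewrite mulrDl.
Qed.

Lemma dsumZ A B c h : c * dsum A B h = dsum A B (fun a b => c * h a b).
Proof.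
rewrite /dsum mulr_sumr; apply: eq_bigr => i _ /=.
by rewrite mulr_sumr; apply: eq_bigr => j _ /=; rewrite mulrA.
Qed.

Lemma dsumN A B h : - dsum A B h = dsum A B (fun a b => - h a b).
Proof. by rewrite -mulN1r dsumZ; congr dsum; apply/funext => a; apply/funext => b; rewrite mulN1r. Qed.

Lemma le_dsum A B h1 h2 : (forall a b, h1 a b <= h2 a b) -> dsum A B h1 <= dsum A B h2.
Proof.
move=> h; apply: ler_sum => i _; apply: ler_sum => j _.
by rewrite ler_wpM2r // overlap_ge0.
Qed.

Lemma dsum_l A B f : dsum A B (fun a _ => f a) = \sum_k f (eigv A k).
Proof.
by apply: eq_bigr => i _; rewrite -mulr_sumr sum_overlap_r mulr1.
Qed.

Lemma dsum_r A B f : dsum A B (fun _ b => f b) = \sum_k f (eigv B k).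
Proof.
rewrite /dsum exchange_big /=.
by apply: eq_bigr => i _; rewrite -mulr_sumr sum_overlap_l mulr1.
Qed.

Lemma Re_tr_mx_fun2 f g A B :
  complex.Re (\tr (mx_fun f A *m mx_fun g B)) = dsum A B (fun a b => f a * g b).
Proof.
rewrite !mx_funE tr_fcalc2 Re_sum; apply: eq_bigr => i _.
rewrite Re_sum; apply: eq_bigr => j _.
by rewrite /cfun -rmorphM Re_real_mul.
Qed.

Lemma Re_tr_l f A B : complex.Re (\tr (mx_fun f A)) = dsum A B (fun a _ => f a).
Proof. by rewrite Re_tr_mx_fun dsum_l. Qed.

Lemma Re_tr_r f A B : complex.Re (\tr (mx_fun f B)) = dsum A B (fun _ b => f b).
Proof. by rewrite Re_tr_mx_fun dsum_r. Qed.

Lemma Re_altern4 (x y z t : R[i]) : complex.Re (x - y - z + t) =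
  complex.Re x - complex.Re y - complex.Re z + complex.Re t.
Proof. by rewrite cReD !cReD !cReN. Qed.

Lemma Re_tr_mulBB f A B : A \is hermsymmx -> B \is hermsymmx ->
  complex.Re (\tr ((A - B) *m (mx_fun f A - mx_fun f B))) =
  dsum A B (fun a b => (a - b) * (f a - f b)).
Proof.
move=> hA hB; have -> : (A - B) *m (mx_fun f A - mx_fun f B) =
  (mx_fun id A - mx_fun id B) *m (mx_fun f A - mx_fun f B) by rewrite !mx_fun_id.
transitivity (dsum A B (fun a _ => a * f a) - dsum A B (fun a b => a * f b) -
    dsum A B (fun a b => f a * b) + dsum A B (fun _ b => b * f b)).
  rewrite tr_mulBB Re_altern4; congr (_ - _ - _ + _).
  - by rewrite mx_funM; exact: Re_tr_l.
  - exact: Re_tr_mx_fun2.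
  - exact: (Re_tr_mx_fun2 f id).
  - by rewrite mx_funM; exact: Re_tr_r.
rewrite !dsumN !dsumD; congr dsum; apply/funext => a; apply/funext => b; ring.
Qed.

Lemma Re_tr_sqrB_mul g A B : A \is hermsymmx -> B \is hermsymmx ->
  complex.Re (\tr ((A - B) *m (A - B) *m mx_fun g A)) =
  dsum A B (fun a b => (a - b) ^+ 2 * g a).
Proof.
move=> hA hB; have -> : (A - B) *m (A - B) *m mx_fun g A =
    (mx_fun id A - mx_fun id B) *m (mx_fun id A - mx_fun id B) *m mx_fun g A.
  by rewrite !mx_fun_id.
transitivity (dsum A B (fun a _ => a * a * g a) - dsum A B (fun a b => g a * a * b) -
    dsum A B (fun a b => a * g a * b) + dsum A B (fun a b => g a * (b * b))).
  rewrite tr_sqrB_mul Re_altern4; congr (_ - _ - _ + _).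
  - by rewrite !mx_funM; exact: Re_tr_l.
  - by rewrite mx_funM; exact: (Re_tr_mx_fun2 _ id).
  - by rewrite mx_funM; exact: (Re_tr_mx_fun2 _ id).
  - by rewrite mx_funM; exact: Re_tr_mx_fun2.
rewrite !dsumN !dsumD; congr dsum; apply/funext => a; apply/funext => b; ring.
Qed.

Lemma dsum_sym A B h : dsum A B h = dsum B A (fun b a => h a b).
Proof.
rewrite /dsum [LHS]exchange_big /=; apply: eq_bigr => i _; apply: eq_bigr => j _.
by rewrite /overlap overlapC_sym.
Qed.

(* Klein-type inequality: a trace inequality for two Hermitian matrices follows
   from the scalar one, the overlaps of the eigenvectors being nonnegative. *)
Lemma mean_value_trace c f g A B : A \is hermsymmx -> B \is hermsymmx ->
  (forall a b, (a - b) * (f a - f b) <= c * ((a - b) ^+ 2 * (g a + g b))) ->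
  complex.Re (\tr ((A - B) *m (mx_fun f A - mx_fun f B))) <=
  c * (complex.Re (\tr ((A - B) *m (A - B) *m mx_fun g A)) +
       complex.Re (\tr ((B - A) *m (B - A) *m mx_fun g B))).
Proof.
move=> hA hB h; rewrite (Re_tr_mulBB f hA hB) (Re_tr_sqrB_mul g hA hB).
rewrite (Re_tr_sqrB_mul g hB hA) (dsum_sym B A) dsumD dsumZ; apply: le_dsum => a b.
by apply: (le_trans (h _ _)); rewrite -[(b - a) ^+ 2]sqrrN opprB mulrDr.
Qed.

(** The scalar bound is summed against the overlaps, and the marginals separate the right-hand side
    into two traces, even when [A] and [B] do not commute. *)
Lemma trace_young f g h A B : A \is hermsymmx ->
  (forall a b, a * g b <= f a + h b) ->
  complex.Re (\tr (A *m mx_fun g B)) <=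
  complex.Re (\tr (mx_fun f A)) + complex.Re (\tr (mx_fun h B)).
Proof.
move=> hA hfgh; rewrite -{1}(mx_fun_id hA) Re_tr_mx_fun2 (Re_tr_l _ A B).
by rewrite (Re_tr_r _ A B) dsumD; apply: le_dsum.
Qed.

End real_functional_calculus.

(** * Scalar inequalities *)

Section scalar_inequalities.
Variable R : realType.
Implicit Types a b x y m s p : R.

Lemma young_powR p x y : 1 <= p -> 0 <= x -> 0 <= y ->
  x * y `^ (p - 1) <= x `^ p / p + (1 - p^-1) * y `^ p.
Proof.
move=> p1 x0 y0; have p0 : 0 < p by lra.
have [->|pn1] := eqVneq p 1.
  by rewrite subrr powRr0 invr1 subrr mul0r addr0 powRr1.
have p1' : 0 < p - 1 by rewrite subr_gt0 lt_neqAle eq_sym pn1.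
have -> : y `^ p = (y `^ (p - 1)) `^ (p / (p - 1)).
  by rewrite -powRrM mulrCA divff ?mulr1 // gt_eqF.
apply: le_trans (conjugate_powR x0 (powR_ge0 _ _) p0 (divr_gt0 p0 p1') _) _.
  by field; rewrite !gt_eqF.
rewrite lerD2l [leRHS]mulrC ler_wpM2l ?powR_ge0 //.
by rewrite le_eqVlt; apply/orP; left; apply/eqP; field; rewrite !gt_eqF.
Qed.

(** Young's inequality with y^2 in the role of y, the coefficients 1/p and 1 - 1/p being bounded by
    1. It provides the majorant for the product of Delta and G(X). *)
Lemma mul_powR_le_add p x y : 1 <= p -> 0 <= x -> 0 <= y ->
  x * y `^ (2 * p - 1 - 1) <= x `^ p + y `^ (2 * p).
Proof.
move=> p1 x0 y0; have pi : 0 <= p^-1 <= 1 by rewrite invr_ge0 invf_le1; lra.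
have -> : 2 * p - 1 - 1 = 2 * (p - 1) by ring.
rewrite !powRrM; apply: le_trans (young_powR p1 x0 (powR_ge0 y 2)) _.
by rewrite lerD // ?ler_piMr ?ler_piMl ?powR_ge0 //; lra.
Qed.

(** After absorption y / p remains on the left, so the 1/p of Young's inequality cancels and the
    constant is exactly [c]. *)
Lemma absorb_fraction p c x y : 1 <= p ->
  y <= c / p * x + (1 - p^-1) * y -> y <= c * x.
Proof.
move=> p1 h; rewrite -(ler_pM2l (_ : 0 < p^-1)) ?invr_gt0 //; last lra.
have -> : p^-1 * (c * x) = c / p * x by ring.
lra.
Qed.

(** Meant for expectations: [a] and [b] belong to one function of the pair and its swap, [c] and [e]
    to another one and its swap. *)
Lemma symmetrized_le s a b c e x : a = x -> a = b -> c = e ->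
  a + b <= s / 2 * (c + e) -> 2 * x <= s * c.
Proof. by move=> -> <- <- h; lra. Qed.

Lemma ler_subst a b c e : a <= b -> a = c -> b = e -> c <= e.
Proof. by move=> h <- <-. Qed.

(* Hermite-Hadamard for the derivative [s x^(s-1)] of [x^s], convex as
   [s - 1 >= 1]. *)
Lemma powR_trapezoid s a b : 2 <= s -> 0 <= b <= a ->
  a `^ s - b `^ s <= s / 2 * ((a - b) * (a `^ (s - 1) + b `^ (s - 1))).
Proof.
move=> s2 /andP[]; rewrite le_eqVlt => /predU1P[<- a0|b0 ba].
  rewrite !powR0 ?gt_eqF ?subr_gt0; [|lra..].
  rewrite subr0 addr0 subr0 mulr_powRB1 //; last lra.
  by rewrite -[leLHS]mul1r ler_wpM2r ?powR_ge0 //; lra.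
(* The right-hand side minus x^s, as a function of the upper endpoint. Since phi(b) = - b^s, the
   claim is phi(b) <= phi(a). *)
pose phi x := s / 2 * ((x - b) * (x `^ (s - 1) + b `^ (s - 1))) - x `^ s.
pose dphi x := s / 2 * ((x `^ (s - 1) + b `^ (s - 1)) +
  (x - b) * ((s - 1) * x `^ (s - 1 - 1))) - s * x `^ (s - 1).
have dphiE x : 0 < x -> is_derive x 1 phi (dphi x).
  move=> x0; have ? := is_derive1_powR (s - 1) x0; have ? := is_derive1_powR s x0.
  apply: is_derive_eq; rewrite /dphi /GRing.scale /=; ring.
have [||c cba phiE] := @MVT_segment _ phi dphi b a ba.
- by move=> x; rewrite in_itv /= => /andP[bx _]; apply: dphiE; exact: lt_trans bx.
- apply: derivable_within_continuous => x; rewrite in_itv /= => /andP[bx _].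
  by have [] := dphiE x (lt_le_trans b0 bx).
have c0 : 0 < c by move: cba; rewrite in_itv /= => /andP[bc _]; exact: lt_le_trans bc.
suff dphi0 : 0 <= dphi c.
  have : 0 <= phi a - phi b by rewrite phiE mulr_ge0 // subr_ge0.
  by rewrite /phi subrr mul0r mulr0 sub0r; lra.
(* With m = s - 1, [dphi c] equals s/2 times b^m + (m-1) c^m - m b c^(m-1). This is nonnegative
   because x^m lies above its tangent at c, which is Young's inequality with exponent m, multiplied
   by m. *)
have m1 : 1 <= s - 1 by lra.
have := young_powR m1 (ltW b0) (ltW c0); set m := s - 1 => hy.
have m0 : 0 < m by rewrite /m; lra.
rewrite /dphi -/m mulrBl -[c * (m * _)]mulrCA mulr_powRB1 ?(ltW c0) //.
have : m * (b * c `^ (m - 1)) <= b `^ m + (m - 1) * c `^ m.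
  apply: le_trans (ler_wpM2l (ltW m0) hy) _; rewrite le_eqVlt; apply/orP; left; apply/eqP.
  by field; rewrite gt_eqF.
have : 0 <= s by lra.
rewrite [b * (m * _)]mulrCA.
move: (m * (b * _)) (b `^ m) (c `^ m) => u v w; rewrite /m; nra.
Qed.

Definition spow s x : R := x * `|x| `^ (s - 1).

(** At s = 1 both sides coincide. For s >= 2, arguments of equal sign reduce by oddness to the
    trapezoid bound on [0, +oo[. *)
Lemma spow_mean_value s a b : s = 1 \/ 2 <= s ->
  (a - b) * (spow s a - spow s b) <=
  s / 2 * ((a - b) ^+ 2 * (`|a| `^ (s - 1) + `|b| `^ (s - 1))).
Proof.
case=> [->|s2].
  rewrite /spow subrr !powRr0 !mulr1.
  by rewrite le_eqVlt; apply/orP; left; apply/eqP; field.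
have s1 : 0 < s - 1 by lra.
have s0 : 0 < s by lra.
have spowE x : 0 <= x -> spow s x = x `^ s.
  by move=> x0; rewrite /spow ger0_norm // mulr_powRB1.
have spowN x : spow s (- x) = - spow s x by rewrite /spow normrN mulNr.
have nneg x y : 0 <= y <= x -> (x - y) * (spow s x - spow s y) <=
  s / 2 * ((x - y) ^+ 2 * (`|x| `^ (s - 1) + `|y| `^ (s - 1))).
  move=> /[dup] xy /andP[y0 yx]; have x0 : 0 <= x by lra.
  rewrite !spowE // !ger0_norm //.
  have := ler_wpM2l (_ : 0 <= x - y) (powR_trapezoid s2 xy).
  by rewrite subr_ge0 => /(_ yx); congr (_ <= _); ring.
(* Opposite signs: with u and v the powers of x and y, x u + y v <= (x + y) (u + v), and s / 2 >= 1
   gives the rest. *)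
have opp x y : 0 <= x -> 0 <= y -> (x + y) * (spow s x + spow s y) <=
  s / 2 * ((x + y) ^+ 2 * (`|x| `^ (s - 1) + `|y| `^ (s - 1))).
  move=> x0 y0; rewrite !spowE // !ger0_norm // -!(@mulr_powRB1 _ _ s) //.
  have := powR_ge0 x (s - 1); have := powR_ge0 y (s - 1).
  move: (x `^ (s - 1)) (y `^ (s - 1)) => u v v0 u0.
  have e : x * u + y * v <= (x + y) * (u + v) by nra.
  have e2 : 0 <= (x + y) * ((x + y) * (u + v)) by rewrite !mulr_ge0 ?addr_ge0.
  have -> : s / 2 * ((x + y) ^+ 2 * (u + v)) =
    s / 2 * ((x + y) * ((x + y) * (u + v))) by ring.
  by apply: (@le_trans _ _ ((x + y) * ((x + y) * (u + v)))); nra.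
wlog ab : a b / b <= a.
  move=> wl; have [/wl//|/ltW/wl h] := leP b a.
  have -> : (a - b) * (spow s a - spow s b) = (b - a) * (spow s b - spow s a) by ring.
  by apply: le_trans h _; rewrite le_eqVlt; apply/orP; left; apply/eqP; ring.
have [b0|b0] := leP 0 b; first by apply: nneg; rewrite b0.
have [a0|a0] := leP 0 a.
  have := opp a (- b) a0; rewrite oppr_ge0 spowN normrN => /(_ (ltW b0)).
  by rewrite ?opprK.
have := nneg (- b) (- a); rewrite !spowN !normrN => h.
have {}h := h ltac:(by apply/andP; split; lra).
have -> : (a - b) * (spow s a - spow s b) =
  (- b - - a) * (- spow s b - - spow s a) by ring.
by apply: le_trans h _; rewrite le_eqVlt; apply/orP; left; apply/eqP; ring.
Qed.

Lemma normr_spow s x : 0 < s -> `|spow s x| = `|x| `^ s.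
Proof. by move=> s0; rewrite normrM [X in _ * X]ger0_norm ?powR_ge0 // mulr_powRB1. Qed.

Lemma mul_spow s x : 0 < s -> x * spow s x = `|x| `^ (s + 1).
Proof.
move=> s0; rewrite mulrA -expr2 -real_normK ?num_real // expr2 -mulrA.
by rewrite mulr_powRB1 // -(@mulr_powRB1 _ _ (s + 1)) ?addrK // addr_gt0.
Qed.

(** The sum is at most twice its larger term, whose power is one of the two on the right. *)
Lemma powR_addl_le r a b : 0 <= r -> 0 <= a -> 0 <= b ->
  (a + b) `^ r <= 2 `^ r * (a `^ r + b `^ r).
Proof.
move=> r0; wlog ab : a b / a <= b.
  move=> wl a0 b0; have [/wl|/ltW/wl] := leP a b; first exact.
  by rewrite [b + a]addrC [_ + a `^ r]addrC; apply.
move=> a0 b0; apply: (@le_trans _ _ ((2 * b) `^ r)).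
  by rewrite ge0_ler_powR ?nnegrE ?addr_ge0 ?mulr_ge0 //; lra.
by rewrite powRM // ler_wpM2l ?powR_ge0 // lerDr powR_ge0.
Qed.

Lemma measurable_spow s : measurable_fun setT (spow s).
Proof.
apply: measurable_funM => //; apply: (measurableT_comp (measurable_powR _)).
exact: normr_measurable.
Qed.

End scalar_inequalities.

(** * Measurability of the functional calculus *)

Section borel_induction.
Variables (R : realType) (K : (R -> R) -> Prop).
Hypothesis Kc : forall c : R, K (fun=> c).
Hypothesis Kid : K id.
Hypothesis KD : forall f g, K f -> K g -> K (fun x => f x + g x).
Hypothesis KM : forall f g, K f -> K g -> K (fun x => f x * g x).
Hypothesis Klim : forall (h : nat -> R -> R) f, (forall n, K (h n)) ->
  (forall x, h ^~ x @ \oo --> f x) -> K f.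

Let Ksum n (h : nat -> R -> R) : (forall k, K (h k)) ->
  K (fun x => \sum_(k < n) h k x).
Proof.
move=> Kh; elim: n => [|n IH].
  by under eq_fun do rewrite big_ord0; exact: Kc.
by under eq_fun do rewrite big_ord_recr; exact: KD.
Qed.

Let Kprod n (h : nat -> R -> R) : (forall k, K (h k)) ->
  K (fun x => \prod_(k < n) h k x).
Proof.
move=> Kh; elim: n => [|n IH].
  by under eq_fun do rewrite big_ord0; exact: Kc.
by under eq_fun do rewrite big_ord_recr; exact: KM.
Qed.

Let KX n f : K f -> K (fun x => f x ^+ n).
Proof.
move=> Kf; have := @Kprod n (fun=> f) (fun=> Kf).
by under eq_fun do rewrite prodr_const card_ord.
Qed.

(** The partial sums of the exponential series are polynomials in [f], and the series converges
    pointwise. *)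
Let Kexp f : K f -> K (fun x => expR (f x)).
Proof.
move=> Kf; apply: (@Klim (fun n x => series (exp_coeff (f x)) n)).
  move=> n; rewrite /series /=.
  under eq_fun do rewrite big_mkord.
  by apply: (@Ksum n (fun k x => f x ^+ k / k`!%:R)) => k; apply: KM; [exact: KX|exact: Kc].
by move=> x; exact: is_cvg_series_exp_coeff.
Qed.

Let KN f : K f -> K (fun x => - f x).
Proof. by move=> Kf; under eq_fun do rewrite -mulN1r; exact: KM. Qed.

Let cvg_exp_neg (c : R) : c < 0 -> (fun n => expR (n%:R * c)) @ \oo --> 0.
Proof.
move=> c0; under eq_fun do rewrite expRM_natl.
by apply: cvg_expr; rewrite ger0_norm ?expR_ge0 // expR_lt1.
Qed.

(* [exp(-exp(n(a-x)))] tends to [1] if [x > a], to [e^-1] if [x = a] and to [0]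
   if [x < a]; powers of this limit then tend to the indicator of [x > a]. *)
Let Kray a : K (\1_(`]a, +oo[%classic : set R)).
Proof.
pose l x : R := if a < x then 1 else if x == a then expR (- 1) else 0.
have Kl : K l.
  apply: (@Klim (fun n x => expR (- expR (n%:R * (a - x))))).
    move=> n; apply/Kexp/KN/Kexp/KM; first exact: Kc.
    by apply: KD; [exact: Kc|exact: KN].
  move=> x; rewrite /l; have [ax|xa|->] := ltgtP a x.
  - have c0 : a - x < 0 by rewrite subr_lt0.
    apply: (@squeeze_cvgr _ _ _ _ (fun n => 1 - expR (n%:R * (a - x))) (fun=> 1)).
    + apply: nearW => n; rewrite expR_ge1Dx /=.
      by rewrite -expR0 ler_expR oppr_le0 expR_ge0.
    + rewrite -[X in _ --> X]subr0; apply: cvgB; [exact: cvg_cst|exact: cvg_exp_neg].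
    + exact: cvg_cst.
  - have c0 : x - a < 0 by rewrite subr_lt0.
    (* With t = n (a - x), exp(- exp t) <= exp(- t), because t <= 1 + t <= exp t. *)
    apply: (@squeeze_cvgr _ _ _ _ (fun=> 0) (fun n => expR (n%:R * (x - a)))).
    + apply: nearW => n; rewrite expR_ge0 /= ler_expR.
      rewrite -[x - a]opprB mulrN lerN2.
      by apply: le_trans (expR_ge1Dx _); rewrite lerDr.
    + exact: cvg_cst.
    + exact: cvg_exp_neg.
  - by under eq_fun do rewrite subrr mulr0 expR0; exact: cvg_cst.
(* The exponent [n.+1] makes the powers of 0 and of 1 constant sequences; at x = a the powers of
   exp(-1) tend to 0, so the ray is open. *)
apply: (@Klim (fun n x => l x ^+ n.+1)); first by move=> n; exact: KX.
move=> x; rewrite indicE /l mem_setE in_itv /= andbT.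
have [ax|xa|_] := ltgtP a x.
- by under eq_fun do rewrite expr1n; exact: cvg_cst.
- by under eq_fun do rewrite expr0n; exact: cvg_cst.
- have e1 : `|expR (-1) : R| < 1 by rewrite ger0_norm ?expR_ge0 // expR_lt1 ltrN10.
  by have := cvg_expr e1; rewrite -cvg_shiftS.
Qed.

(** The sets whose indicator lies in [K] form a sigma-algebra containing the rays: the indicator of
    a countable union is the limit of 1 minus the finite products of the complementary
    indicators. *)
Let Kindic (B : set R) : measurable B -> K (\1_B).
Proof.
move=> mB; have : (@RGenOInfty.G R).-sigma.-measurable B.
  by rewrite -RGenOInfty.measurableE.
move: B {mB}; apply: (@smallest_sub _ _ _ [set B : set R | K (\1_B)]); last first.
  by move=> _ [a ->]; exact: Kray.
have KC (A : set R) : K (\1_A) -> K (fun x => 1 - \1_A x).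
  by move=> KA; apply: KD; [exact: Kc|exact: KN].
split => /=.
- by rewrite indic0; exact: Kc.
- move=> A KA; rewrite setTD; have -> : \1_(~` A) = (fun x => 1 - \1_A x) :> (R -> R).
    by apply/funext => x; rewrite !indicE in_setC; case: (_ \in _); rewrite ?subr0 ?subrr.
  exact: KC.
- move=> A KA; apply: (@Klim (fun n x => 1 - \prod_(k < n) (1 - \1_(A k) x))).
    move=> n; apply: KD; first exact: Kc.
    by apply: KN; apply: (@Kprod n (fun k x => 1 - \1_(A k) x)) => k; exact: KC.
  move=> x; have [[N _ ANx]|Ax] := pselect ((\bigcup_k A k) x).
    rewrite indicE mem_set; last by exists N.
    apply: cvg_near_cst; exists N.+1 => // n /= Nn.
    by rewrite (bigD1 (Ordinal Nn)) //= indicE mem_set // subrr mul0r subr0.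
  rewrite indicE memNset //; apply: cvg_near_cst; apply: nearW => n.
  rewrite big1 ?subrr // => k _; rewrite indicE memNset ?subr0 // => Akx.
  by apply: Ax; exists k.
Qed.

Import HBNNSimple.

(** A nonnegative Borel function is a pointwise limit of simple functions, which are finite
    combinations of indicators; the general case is the difference of positive and negative
    parts. *)
Lemma borel_ind f : measurable_fun setT f -> K f.
Proof.
have Knneg (h : R -> R) : measurable_fun setT h -> (forall x, 0 <= h x) -> K h.
  move=> mh h0; have mEh : measurable_fun [set: R] (EFin \o h) by exact/measurable_EFinP.
  pose g n : R -> R := nnsfun_approx measurableT mEh n.
  apply: (@Klim g).
    move=> n; rewrite (funext (fimfunEord (nnsfun_approx measurableT mEh n)) : g n = _).
    set s := fset_set _.
    apply: (@Ksum _ (fun i x => (finmap.enum_fset s)`_i * \1_(g n @^-1` [set (finmap.enum_fset s)`_i]) x)) => i.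
    apply: KM; first exact: Kc.
    exact: Kindic.
  move=> x; have hx := cvg_nnsfun_approx measurableT mEh (fun y _ => h0 y) (I : setT x).
  exact: (fine_cvg hx).
move=> mf; rewrite -[f]funrposBneg.
apply: KD; first by apply: Knneg => [|x]; [exact: measurable_funrpos|exact: funrpos_ge0].
by apply: KN; apply: Knneg => [|x]; [exact: measurable_funrneg|exact: funrneg_ge0].
Qed.

End borel_induction.

(** * Measurable matrix-valued maps *)

Section measurable_matrices.
Context d' (T : measurableType d') (R : realType) (d : nat).
Implicit Types (F G : T -> 'M[R[i]]_d).

Lemma measurable_mxD F G : measurable_mx F -> measurable_mx G ->
  measurable_mx (fun x => F x + G x).
Proof.
move=> mF mG i j; have [? ?] := mF i j; have [? ?] := mG i j; split.
  by under eq_fun do rewrite mxE cReD; exact: measurable_funD.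
by under eq_fun do rewrite mxE cImD; exact: measurable_funD.
Qed.

Lemma measurable_mxN F : measurable_mx F -> measurable_mx (fun x => - F x).
Proof.
move=> mF i j; have [? ?] := mF i j; split.
  by under eq_fun do rewrite mxE cReN; exact: measurable_funN.
by under eq_fun do rewrite mxE cImN; exact: measurable_funN.
Qed.

Lemma measurable_mxM F G : measurable_mx F -> measurable_mx G ->
  measurable_mx (fun x => F x *m G x).
Proof.
move=> mF mG i j; split.
  under eq_fun do rewrite mxE Re_sum; apply: measurable_sum => k.
  have [? ?] := mF i k; have [? ?] := mG k j.
  by under eq_fun do rewrite cReM; apply: measurable_funB; exact: measurable_funM.
under eq_fun do rewrite mxE Im_sum; apply: measurable_sum => k.
have [? ?] := mF i k; have [? ?] := mG k j.
by under eq_fun do rewrite cImM; apply: measurable_funD; exact: measurable_funM.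
Qed.

Lemma measurable_mx_adj F : measurable_mx F -> measurable_mx (fun x => (F x)^t*).
Proof.
move=> mF i j; have [? ?] := mF j i; split.
  by under eq_fun do rewrite !mxE cRe_conj.
by under eq_fun do rewrite !mxE cIm_conj; exact: measurable_funN.
Qed.

Lemma measurable_mxZ (c : R) F : measurable_mx F ->
  measurable_mx (fun x => c%:C *: F x).
Proof.
move=> mF i j; have [? ?] := mF i j; split.
  by under eq_fun do rewrite mxE Re_real_mul; exact: measurable_funM.
by under eq_fun do rewrite mxE Im_real_mul; exact: measurable_funM.
Qed.

Lemma measurable_Re_tr F : measurable_mx F ->
  measurable_fun setT (fun x => complex.Re (\tr (F x))).
Proof.
move=> mF; under eq_fun do rewrite /mxtrace Re_sum.
by apply: measurable_sum => k; have [] := mF k k.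
Qed.

Local Opaque mx_fun.

(** Induction on [f]: sums and products of functions become matrix sums and products, and the
    identity gives back [F]. For a pointwise limit, x is fixed and so is its eigenbasis; the entries
    are then finite sums of convergent terms. *)
Lemma measurable_mx_fun f F : (forall x, F x \is hermsymmx) -> measurable_mx F ->
  measurable_fun setT f -> measurable_mx (fun x => mx_fun f (F x)).
Proof.
move=> hF mF.
apply: (@borel_ind R (fun g => measurable_mx (fun x => mx_fun g (F x)))) => {f}.
- move=> c; under eq_fun do rewrite mx_fun_cst.
  by move=> i j; split; exact: measurable_cst.
- by under eq_fun => x do rewrite (mx_fun_id (hF x)).
- move=> f g mf mg; rewrite (_ : (fun x => _) = (fun x => mx_fun f (F x) + mx_fun g (F x))).
    exact: (measurable_mxD mf mg).
  by apply/funext => x; exact: mx_funD.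
- move=> f g mf mg; rewrite (_ : (fun x => _) = (fun x => mx_fun f (F x) *m mx_fun g (F x))).
    exact: (measurable_mxM mf mg).
  by apply/funext => x; rewrite mx_funM.
- move=> h f mh hf i j; split.
    apply: (@measurable_fun_cvg _ _ _ _ (fun n x => complex.Re (mx_fun (h n) (F x) i j))).
      by move=> n; have [] := mh n i j.
    move=> x _; rewrite (Re_mx_fun f (F x) i j).
    under eq_fun => m do rewrite (Re_mx_fun (h m) (F x) i j).
    apply: cvg_big => [|k _]; first exact: add_continuous.
    by apply: cvgM; [exact: hf|exact: cvg_cst].
  apply: (@measurable_fun_cvg _ _ _ _ (fun n x => complex.Im (mx_fun (h n) (F x) i j))).
    by move=> n; have [] := mh n i j.
  move=> x _; rewrite (Im_mx_fun f (F x) i j).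
    under eq_fun => m do rewrite (Im_mx_fun (h m) (F x) i j).
  apply: cvg_big => [|k _]; first exact: add_continuous.
  by apply: cvgM; [exact: hf|exact: cvg_cst].
Qed.

End measurable_matrices.

(** * Conditional expectation and exchangeability *)

Section real_integrals.
Context d (T : measurableType d) (R : realType) (mu : {measure set T -> \bar R}).
Implicit Types f g b : T -> R.
Local Notation itg f := (mu.-integrable setT (EFin \o f)).

Lemma ritgD f g : itg f -> itg g -> itg (fun w => f w + g w).
Proof. exact: integrableD. Qed.

Lemma ritgN f : itg f -> itg (fun w => - f w).
Proof. by move=> hf; have := integrableN hf; apply: eq_integrable. Qed.

Lemma ritgZ c f : itg f -> itg (fun w => c * f w).
Proof. exact: integrableZl. Qed.

Lemma ritg_sum I (s : seq I) (f : I -> T -> R) : (forall i, itg (f i)) ->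
  itg (fun w => \sum_(i <- s) f i w).
Proof.
move=> hf; elim: s => [|i s IH].
  under eq_fun do rewrite big_nil.
  exact: integrable0.
by under eq_fun do rewrite big_cons; exact: ritgD.
Qed.

Lemma Rintegral_sum I (s : seq I) (f : I -> T -> R) : (forall i, itg (f i)) ->
  \int[mu]_w (\sum_(i <- s) f i w) = \sum_(i <- s) \int[mu]_w f i w.
Proof.
move=> hf; elim: s => [|i s IH].
  by rewrite big_nil; under eq_Rintegral do rewrite big_nil; rewrite Rintegral_cst // mul0r.
rewrite big_cons -IH -RintegralD //; last exact: ritg_sum.
by apply: eq_Rintegral => w _; rewrite big_cons.
Qed.

Lemma ae_le_itg f b : measurable_fun setT f -> itg b ->
  {ae mu, forall w, `|f w| <= b w} -> itg f.
Proof.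
move=> mf /integrableP[mb boo] fb; apply/integrableP; split.
  exact/measurable_EFinP.
apply: le_lt_trans boo; apply: ae_ge0_le_integral => //.
- by apply: measurableT_comp => //; exact/measurable_EFinP.
- exact: measurableT_comp.
- apply: filterS fb => w fb _ /=; rewrite lee_fin.
  by apply: le_trans fb _; exact: ler_norm.
Qed.

Lemma le_itg f b : measurable_fun setT f -> itg b ->
  (forall w, `|f w| <= b w) -> itg f.
Proof. by move=> mf hb fb; apply: (ae_le_itg mf hb); apply: aeW. Qed.

Lemma ae_eq_Rintegral f g : itg f -> itg g -> {ae mu, forall w, f w = g w} ->
  \int[mu]_w f w = \int[mu]_w g w.
Proof.
move=> hf hg fg; congr fine; apply: ae_eq_integral => //.
- exact: (measurable_int _ hf).
- exact: (measurable_int _ hg).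
- by apply: filterS fg => w /= -> _.
Qed.

(** Almost everywhere g - f equals its absolute value, whose integral is nonnegative. *)
Lemma ae_le_Rintegral f g : itg f -> itg g -> {ae mu, forall w, f w <= g w} ->
  \int[mu]_w f w <= \int[mu]_w g w.
Proof.
move=> hf hg fg; rewrite -subr_ge0 -RintegralB //.
have hgf : itg (fun w => g w - f w) by apply: ritgD => //; exact: ritgN.
have -> : \int[mu]_w (g w - f w) = \int[mu]_w `|g w - f w|.
  apply: ae_eq_Rintegral hgf (integrable_norm hgf) _.
  by apply: filterS fg => w fgw /=; rewrite ger0_norm ?subr_ge0.
by apply: Rintegral_ge0 => w _.
Qed.

End real_integrals.

Section conditional_expectation.
Context d d' (T : measurableType d) (E : measurableType d') (R : realType).
Variables (P : probability T R) (Z : T -> E).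
Hypothesis mZ : measurable_fun setT Z.
Implicit Types (D f g Y : T -> R) (h : E -> R).
Local Notation itg f := (P.-integrable setT (EFin \o f)).

Let Rintegral_indic D (A : set E) : measurable A ->
  \int[P]_w (D w * \1_A (Z w)) = fine (\int[P]_(w in Z @^-1` A) (D w)%:E).
Proof.
move=> mA; rewrite integral_mkcond /Rintegral; congr fine.
apply: eq_integral => w _; rewrite /patch indicE.
have -> : (w \in Z @^-1` A) = (Z w \in A) by apply/idP/idP; rewrite !inE.
by case: ifP => _; rewrite ?mulr1 ?mulr0.
Qed.

Let itg_indic D (A : set E) : itg D -> measurable A ->
  itg (fun w => D w * \1_A (Z w)).
Proof.
move=> iD mA; have /integrableP[/measurable_EFinP mD _] := iD.
apply: (@le_itg _ _ _ P _ (fun w => `|D w|)).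
- apply: measurable_funM => //; apply: measurableT_comp => //.
- exact: integrable_norm.
- move=> w; rewrite normrM indicE; case: (_ \in _); rewrite ?normr1 ?normr0 ?mulr1 //.
  by rewrite mulr0.
Qed.

Import HBNNSimple.

(** For simple functions of [Z] this is linearity. The approximations of [h] stay below [h], so |D
    h(Z)| dominates in the passage to the limit. *)
Let orthogonal_ge0 D h : itg D ->
  (forall A, measurable A -> (\int[P]_(w in Z @^-1` A) (D w)%:E = 0)%E) ->
  measurable_fun setT h -> (forall z, 0 <= h z) -> itg (fun w => D w * h (Z w)) ->
  \int[P]_w (D w * h (Z w)) = 0.
Proof.
move=> iD D0 mh h0 iDh.
have mEh : measurable_fun [set: E] (EFin \o h) by exact/measurable_EFinP.
have h0' z : [set: E] z -> (0 <= (EFin \o h) z)%E by move=> _; rewrite lee_fin.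
pose s n : E -> R := nnsfun_approx measurableT mEh n.
have ms n : measurable_fun setT (s n) by rewrite /s; exact: measurable_funP.
have cs z : s ^~ z @ \oo --> h z by exact: fine_cvg (cvg_nnsfun_approx measurableT mEh h0' I).
have sh n z : s n z <= h z.
  rewrite -[h z](cvg_lim _ (cs z)) //; apply: nondecreasing_cvgn_le.
    by move=> m k mk; have /lefP := nd_nnsfun_approx measurableT mEh mk; exact.
  by apply/cvg_ex; exists (h z); exact: cs.
have mD : measurable_fun setT D by have /integrableP[/measurable_EFinP] := iD.
have Ds0 n : \int[P]_w (D w * s n (Z w)) = 0.
  rewrite (funext (fimfunEord (nnsfun_approx measurableT mEh n)) : s n = _).
  set S := finmap.enum_fset _.
  under eq_Rintegral do rewrite mulr_sumr.
  rewrite Rintegral_sum => [|i].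
    rewrite big1 // => i _; under eq_Rintegral do rewrite mulrCA.
    rewrite RintegralZl //; last exact: itg_indic.
    by rewrite Rintegral_indic // D0 // mulr0.
  by under eq_fun do rewrite mulrCA; apply: ritgZ; exact: itg_indic.
have [||||_ _ hl] := @dominated_convergence _ _ _ P setT measurableT
  (fun n w => (D w * s n (Z w))%:E) (fun w => (D w * h (Z w))%:E)
  (fun w => `|D w * h (Z w)|%:E) _ _ _ (integrable_norm iDh).
- move=> n; apply/measurable_EFinP; apply: measurable_funM => //.
  exact: measurableT_comp.
- by have /integrableP[] := iDh.
- apply: aeW => w _; apply/cvg_EFin; first exact: nearW.
  by apply: cvgM; [exact: cvg_cst|exact: cs].
- apply: aeW => w n _; rewrite lee_fin !normrM ler_wpM2l //.
  by rewrite !ger0_norm // /s.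
have e0 n : (\int[P]_w (D w * s n (Z w))%:E = 0)%E.
  rewrite -[LHS]fineK ?(congr1 EFin (Ds0 n)) //.
  apply: integrable_fin_num => //.
  apply: (@le_itg _ _ _ P (fun w => D w * s n (Z w)) (fun w => `|D w * h (Z w)|)).
  - by apply: measurable_funM => //; exact: measurableT_comp.
  - exact: integrable_norm.
  - by move=> w; rewrite !normrM ler_wpM2l // !ger0_norm // /s.
rewrite /Rintegral.
have : (fun=> 0%E) @ \oo --> (\int[P]_w (D w * h (Z w))%:E)%E.
  by move: hl; under eq_fun do rewrite e0.
by move=> /cvg_lim <- //; rewrite lim_cst.
Qed.

(** [h] may be unbounded; only the product with [D] is integrable. As h^+ and h^- are at most |h|,
    integrability passes to both parts. *)
Lemma cond_zero_orthogonal D h : itg D ->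
  (forall A, measurable A -> (\int[P]_(w in Z @^-1` A) (D w)%:E = 0)%E) ->
  measurable_fun setT h -> itg (fun w => D w * h (Z w)) ->
  \int[P]_w (D w * h (Z w)) = 0.
Proof.
move=> iD D0 mh iDh.
have mD : measurable_fun setT D by have /integrableP[/measurable_EFinP] := iD.
have ih (k : E -> R) : measurable_fun setT k -> (forall z, `|k z| <= `|h z|) ->
    itg (fun w => D w * k (Z w)).
  move=> mk kh.
  apply: (@le_itg _ _ _ P (fun w => D w * k (Z w)) (fun w => `|D w * h (Z w)|)).
  - by apply: measurable_funM => //; exact: measurableT_comp.
  - exact: integrable_norm.
  - by move=> w; rewrite !normrM ler_wpM2l.
have hpn z : h z = h^\+ z - h^\- z by rewrite -[in LHS](funrposBneg h).
have hs z : `|h z| = h^\+ z + h^\- z by exact: (congr1 (fun k => k z) (esym (funrposDneg h))).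
have ipos : itg (fun w => D w * h^\+ (Z w)).
  apply: ih => [|z]; first exact: measurable_funrpos.
  by rewrite hs ger0_norm ?funrpos_ge0 // lerDl funrneg_ge0.
have ineg : itg (fun w => D w * h^\- (Z w)).
  apply: ih => [|z]; first exact: measurable_funrneg.
  by rewrite hs ger0_norm ?funrneg_ge0 // lerDr funrpos_ge0.
transitivity (\int[P]_w (D w * h^\+ (Z w) - D w * h^\- (Z w))).
  by apply: eq_Rintegral => w _; rewrite -mulrBr -hpn.
rewrite RintegralB // (@orthogonal_ge0 _ h^\+) ?(@orthogonal_ge0 _ h^\-) ?subrr //.
all: by [move=> z; exact: funrneg_ge0|move=> z; exact: funrpos_ge0
  |exact: measurable_funrneg|exact: measurable_funrpos].
Qed.

Let cond_exp_sub Y g : is_cond_exp P Z Y g -> itg (fun w => Y w - g w) /\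
  forall A, measurable A -> (\int[P]_(w in Z @^-1` A) (Y w - g w)%:E = 0)%E.
Proof.
move=> [iY ig _ Yg]; have iYg : itg (fun w => Y w - g w).
  by apply: ritgD => //; exact: ritgN.
split => // A mA; have mZA : measurable (Z @^-1` A) by rewrite -[X in measurable X]setTI; exact: mZ.
have jY : P.-integrable (Z @^-1` A) (EFin \o Y) by exact: integrableS iY.
have jg : P.-integrable (Z @^-1` A) (EFin \o g) by exact: integrableS ig.
have := integralB mZA jY jg; under eq_integral do rewrite /= -EFinB.
move=> ->; rewrite /= Yg // subee //; exact: integrable_fin_num.
Qed.

Lemma cond_exp_pull_out Y g h : is_cond_exp P Z Y g -> measurable_fun setT h ->
  itg (fun w => Y w * h (Z w)) -> itg (fun w => g w * h (Z w)) ->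
  \int[P]_w (Y w * h (Z w)) = \int[P]_w (g w * h (Z w)).
Proof.
move=> Yg mh iYh igh; have [iD D0] := cond_exp_sub Yg.
apply/eqP; rewrite -subr_eq0 -RintegralB //; apply/eqP.
transitivity (\int[P]_w ((Y w - g w) * h (Z w))).
  by apply: eq_Rintegral => w _; rewrite mulrBl.
apply: cond_zero_orthogonal => //; under eq_fun do rewrite mulrBl.
by apply: ritgD => //; exact: ritgN.
Qed.

Lemma cond_exp_measurable Y g : is_cond_exp P Z Y g -> measurable_fun setT g.
Proof. by move=> [_ /integrableP[/measurable_EFinP]]. Qed.

(** The difference [D] of two versions is measurable for the sigma-algebra of [Z], so its sign is a
    function h of [Z] (with value 1 where [D] vanishes), and |D| = D h(Z) integrates to zero. *)
Lemma cond_exp_unique Y g1 g2 : is_cond_exp P Z Y g1 -> is_cond_exp P Z Y g2 ->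
  {ae P, forall w, g1 w = g2 w}.
Proof.
move=> Yg1 Yg2; have [iD1 D1] := cond_exp_sub Yg1; have [iD2 D2] := cond_exp_sub Yg2.
have [_ i1 m1 e1] := Yg1; have [_ i2 m2 e2] := Yg2.
pose D w := g1 w - g2 w.
have iD : itg D by apply: ritgD => //; exact: ritgN.
have mD : measurable_fun setT D by have /integrableP[/measurable_EFinP] := iD.
have [A mA DA] : exists2 A, measurable A & [set w | 0 <= D w] = Z @^-1` A.
  have : @measurable_fun _ _ (g_sigma_algebra_preimageType Z) R setT D.
    by apply: measurable_funB => _ B mB; rewrite setTI; [exact: m1|exact: m2].
  move=> /(_ measurableT _ (measurable_itv `[0, +oo[))[A mA] /=.
  rewrite !setTI => eA; exists A => //; rewrite eA.
  by apply/seteqP; split => w /=; rewrite in_itv /= andbT.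
have D0 B : measurable B -> (\int[P]_(w in Z @^-1` B) (D w)%:E = 0)%E.
  move=> mB; have mZB : measurable (Z @^-1` B) by rewrite -[X in measurable X]setTI; exact: mZ.
  have jY : P.-integrable (Z @^-1` B) (EFin \o g1) by exact: integrableS i1.
  have jg : P.-integrable (Z @^-1` B) (EFin \o g2) by exact: integrableS i2.
  have := integralB mZB jY jg; under eq_integral do rewrite /= -EFinB.
  move=> ->; rewrite /= e1 // e2 // subee // -e1 //; exact: integrable_fin_num.
have D0' : \int[P]_w `|D w| = 0.
  pose h z : R := 2 * \1_A z - 1.
  have Dh w : `|D w| = D w * h (Z w).
    rewrite /h indicE; have -> : (Z w \in A) = (0 <= D w).
      by apply/idP/idP; rewrite inE -[A _]/((Z @^-1` A) w) -DA.
    have [Dw|Dw] := leP 0 (D w); first by rewrite ger0_norm //=; ring.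
    by rewrite ltr0_norm //=; ring.
  under eq_Rintegral do rewrite Dh.
  apply: cond_zero_orthogonal => //.
    by apply: measurable_funB => //; apply: measurable_funM.
  by under eq_fun do rewrite -Dh; exact: integrable_norm.
have /ae_eq_integral_abs : (\int[P]_w `|(D w)%:E| = 0)%E.
  rewrite -[LHS]fineK ?(congr1 EFin D0') //.
  exact: (integrable_fin_num _ (integrable_norm iD)).
move=> /(_ measurableT) [|N [mN N0 DN]]; first exact/measurable_EFinP.
exists N; split => // w Dw; apply: DN => /= Dw0; apply: Dw.
by move: (Dw0 I) => [] /eqP; rewrite subr_eq0 => /eqP.
Qed.

Lemma cond_expN Y g : is_cond_exp P Z Y g ->
  is_cond_exp P Z (fun w => - Y w) (fun w => - g w).
Proof.
move=> [iY ig mg Yg]; split; [exact: ritgN|exact: ritgN| |].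
  move=> B mB; apply: (mg (-%R @^-1` B)).
  rewrite -[X in measurable X]setTI.
  exact: (measurable_funN (@measurable_id _ R setT)).
move=> A mA; have mZA : measurable (Z @^-1` A) by rewrite -[X in measurable X]setTI; exact: mZ.
under eq_integral do rewrite -mulN1r EFinM.
under [RHS]eq_integral do rewrite -mulN1r EFinM.
rewrite (integralZl mZA (integrableS measurableT mZA _ ig)) //.
by rewrite (integralZl mZA (integrableS measurableT mZA _ iY)) //= Yg.
Qed.

(** Opposite entries of [Y] are conjugate, so the matching real and imaginary parts of [W] are
    versions of the same conditional expectation, up to sign. Uniqueness of versions gives the
    symmetry only almost surely. *)
Lemma cond_exp_mx_herm n (Y W : T -> 'M[R[i]]_n) : is_cond_exp_mx P Z Y W ->
  (forall w, Y w \is hermsymmx) -> {ae P, forall w, W w \is hermsymmx}.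
Proof.
move=> YW hY.
have Yc i j w : Y w i j = Num.conj (Y w j i).
  by rewrite -[in LHS](hermsymmxP _ (hY w)) !mxE.
have hre i j : {ae P, forall w, complex.Re (W w i j) = complex.Re (W w j i)}.
  have [+ _] := YW i j; under [fun w => complex.Re (Y w i j)]eq_fun do rewrite Yc cRe_conj.
  by move=> /cond_exp_unique; apply; have [] := YW j i.
have him i j : {ae P, forall w, complex.Im (W w i j) = - complex.Im (W w j i)}.
  have [_ +] := YW i j; under [fun w => complex.Im (Y w i j)]eq_fun do rewrite Yc cIm_conj.
  by move=> /cond_exp_unique; apply; have [_ /cond_expN] := YW j i.
have : {ae P, forall w, forall i j, complex.Re (W w i j) = complex.Re (W w j i) /\
    complex.Im (W w i j) = - complex.Im (W w j i)}.
  apply: filter_forall => i; apply: filter_forall => j.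
  by apply: filterS2 (hre i j) (him i j) => w.
apply: filterS => w hw; apply/hermsymmxP/matrixP => i j; rewrite !mxE.
have [hr hi] := hw i j; apply/eqP; rewrite eq_complex cRe_conj cIm_conj.
by rewrite -hr -hi !eqxx.
Qed.

End conditional_expectation.

(** * Exchangeable pairs *)

Section exchangeability.
Context d d' (T : measurableType d) (E : measurableType d') (R : realType).
Variables (P : probability T R) (Z Z' : T -> E).
Hypotheses (mZ : measurable_fun setT Z) (mZ' : measurable_fun setT Z').
Hypothesis ZZ' : exchangeable P Z Z'.

Let exch_ge0 (phi : E * E -> \bar R) : measurable_fun setT phi ->
  (forall x, (0 <= phi x)%E) ->
  (\int[P]_w phi (Z w, Z' w) = \int[P]_w phi (Z' w, Z w))%E.
Proof.
move=> mphi phi0.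
have m1 : measurable_fun setT (fun w => (Z w, Z' w)) by exact: measurable_fun_pair.
have m2 : measurable_fun setT (fun w => (Z' w, Z w)) by exact: measurable_fun_pair.
transitivity (\int[pushforward P (fun w => (Z w, Z' w))]_x phi x)%E.
  by rewrite (ge0_integral_pushforward m1).
transitivity (\int[pushforward P (fun w => (Z' w, Z w))]_x phi x)%E; last first.
  by rewrite (ge0_integral_pushforward m2).
by apply: eq_measure_integral => C mC _; exact: ZZ'.
Qed.

(** Both integrals are taken against the common law of the two pairs. With extended-real values the
    identity, applied to |phi|, also transfers integrability. *)
Lemma exchangeable_integral (phi : E * E -> \bar R) : measurable_fun setT phi ->
  (\int[P]_w phi (Z w, Z' w) = \int[P]_w phi (Z' w, Z w))%E.
Proof.
move=> mphi; rewrite integralE [RHS]integralE; congr (_ - _)%E.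
  transitivity (\int[P]_w (phi^\+ (Z w, Z' w)))%E.
    by apply: eq_integral => w _; rewrite !funeposE.
  rewrite (exch_ge0 (measurable_funepos mphi) (funepos_ge0 phi)).
  by apply: eq_integral => w _; rewrite !funeposE.
transitivity (\int[P]_w (phi^\- (Z w, Z' w)))%E.
  by apply: eq_integral => w _; rewrite !funenegE.
rewrite (exch_ge0 (measurable_funeneg mphi) (funeneg_ge0 phi)).
by apply: eq_integral => w _; rewrite !funenegE.
Qed.

Lemma exchangeable_Rintegral (phi : E * E -> R) : measurable_fun setT phi ->
  \int[P]_w phi (Z w, Z' w) = \int[P]_w phi (Z' w, Z w).
Proof.
move=> mphi; congr fine.
by apply: (@exchangeable_integral (EFin \o phi)); exact/measurable_EFinP.
Qed.

Lemma exchangeable_integrable (phi : E * E -> R) : measurable_fun setT phi ->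
  P.-integrable setT (EFin \o (fun w => phi (Z w, Z' w))) ->
  P.-integrable setT (EFin \o (fun w => phi (Z' w, Z w))).
Proof.
move=> mphi /integrableP[m1 h1]; apply/integrableP; split.
  apply/measurable_EFinP; apply: (measurableT_comp mphi).
  exact: measurable_fun_pair.
move: h1; have := @exchangeable_integral (fun x => `|phi x|%:E).
by rewrite /= => ->//; apply/measurable_EFinP; exact: measurableT_comp.
Qed.

End exchangeability.

(** * Schatten norms *)

Section schatten.
Variables (R : realType) (d : nat).
Implicit Types (A B : 'M[R[i]]_d) (p q : R).

Lemma Re_tr_mulmx A B : complex.Re (\tr (A *m B)) =
  \sum_i \sum_j (complex.Re (A i j) * complex.Re (B j i) -
                 complex.Im (A i j) * complex.Im (B j i)).
Proof.
rewrite /mxtrace Re_sum; apply: eq_bigr => i _.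
by rewrite mxE Re_sum; apply: eq_bigr => j _; rewrite cReM.
Qed.

Lemma schatten_norm_ge0 p A : 0 <= schatten_norm p A.
Proof. exact: powR_ge0. Qed.

Lemma schatten_norm_herm p A : A \is hermsymmx ->
  schatten_norm p A = (\sum_k `|eigv A k| `^ p) `^ p^-1.
Proof.
by move=> hA; rewrite /schatten_norm mx_abs_herm // mx_fun_comp Re_tr_mx_fun.
Qed.

Lemma schatten_norm_powR p A : A \is hermsymmx -> p != 0 ->
  schatten_norm p A `^ p = \sum_k `|eigv A k| `^ p.
Proof.
move=> hA p0; rewrite schatten_norm_herm // -powRrM mulVf // powRr1 //.
by apply: sumr_ge0 => k _; exact: powR_ge0.
Qed.

Lemma eigv_le_schatten p A k : A \is hermsymmx -> 0 < p ->
  `|eigv A k| <= schatten_norm p A.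
Proof.
move=> hA p0; rewrite schatten_norm_herm //.
rewrite -[leLHS](powRr1 (normr_ge0 _)) -(mulfV (lt0r_neq0 p0)) powRrM.
rewrite ge0_ler_powR ?invr_ge0 ?(ltW p0) ?nnegrE ?powR_ge0 //.
  by apply: sumr_ge0 => j _; exact: powR_ge0.
by rewrite (bigD1 k) //= lerDl; apply: sumr_ge0 => j _; exact: powR_ge0.
Qed.

Lemma herm_entry_le p A i j : A \is hermsymmx -> 0 < p ->
  `|A i j| <= (schatten_norm p A *+ d)%:C.
Proof.
move=> hA p0; rewrite -{1}(mx_fun_id hA); apply: mx_fun_entry_le => k.
exact: eigv_le_schatten.
Qed.

(** Each eigenvalue is at most the Schatten norm of any positive index, so the growth exponent [q]
    of [f] is independent of [p]. It is used with norm index 2p and growth s or s - 1. *)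
Lemma mx_fun_powR_entry_le (f : R -> R) p q A i j : A \is hermsymmx -> 0 < p ->
  0 <= q -> (forall x, `|f x| <= `|x| `^ q) ->
  `|mx_fun f A i j| <= (schatten_norm p A `^ q *+ d)%:C.
Proof.
move=> hA p0 q0 fq; apply: mx_fun_entry_le => k; apply: (le_trans (fq _)).
by rewrite ge0_ler_powR ?nnegrE ?schatten_norm_ge0 // eigv_le_schatten.
Qed.

Lemma tr_mul_spow s A : A \is hermsymmx -> 0 < s ->
  complex.Re (\tr (A *m mx_fun (spow s) A)) = schatten_norm (s + 1) A `^ (s + 1).
Proof.
move=> hA s0; rewrite -{1}(mx_fun_id hA) mx_funM Re_tr_mx_fun.
rewrite schatten_norm_powR //; last by rewrite gt_eqF // addr_gt0.
by apply: eq_bigr => k _; exact: mul_spow.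
Qed.

(** Scalar Young's inequality at x = (2p-1) |a| and y = b^2. With the factor 2p-1 on x, the
    coefficient of the [B] term stays 1 - 1/p < 1, as absorption requires. *)
Lemma schatten_young p A B : 1 <= p -> A \is hermsymmx -> B \is hermsymmx ->
  (2 * p - 1) *
    complex.Re (\tr (A *m mx_fun (fun x => `|x| `^ (2 * p - 1 - 1)) B)) <=
  (2 * p - 1) `^ p / p * schatten_norm p A `^ p +
    (1 - p^-1) * schatten_norm (2 * p) B `^ (2 * p).
Proof.
move=> p1 hA hB; have p0 : 0 < p by lra.
have s0 : 0 < 2 * p - 1 by lra.
rewrite [leRHS](_ : _ = (2 * p - 1) `^ p / p * (\sum_k `|eigv A k| `^ p) +
    (1 - p^-1) * \sum_k `|eigv B k| `^ (2 * p)); last first.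
  by congr (_ * _ + _ * _); apply: schatten_norm_powR; rewrite ?gt_eqF //; lra.
(* [trace_young] has no coefficient on its left-hand side, so [f] and [h] are divided by 2p - 1 and
   the factor is restored afterwards. *)
pose f (x : R) : R := (2 * p - 1) `^ p / p * `|x| `^ p / (2 * p - 1).
pose h (x : R) : R := (1 - p^-1) * `|x| `^ (2 * p) / (2 * p - 1).
have := @trace_young R d f (fun x => `|x| `^ (2 * p - 1 - 1)) h A B hA.
rewrite !Re_tr_mx_fun -2!mulr_suml -2!mulr_sumr -mulrDl ler_pdivlMr // [X in _ -> X <= _]mulrC.
apply => a b; rewrite /f /h -mulrDl ler_pdivlMr // -mulrA mulrC.
have -> : `|b| `^ (2 * p - 1 - 1) = (`|b| `^ 2) `^ (p - 1).
  by rewrite -powRrM; congr (_ `^ _); ring.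
have := young_powR p1 (normr_ge0 ((2 * p - 1) * a)) (powR_ge0 `|b| 2).
rewrite normrM (ger0_norm (ltW s0)) (powRM p (ltW s0) (normr_ge0 a)).
rewrite (powRrM `|b| 2 p) => hy; apply: le_trans (le_trans hy _); last first.
  by rewrite le_eqVlt; apply/orP; left; apply/eqP; ring.
move: hy => _.
rewrite -[leRHS]mulrA ler_wpM2l ?(ltW s0) // ler_wpM2r ?powR_ge0 //.
exact: ler_norm.
Qed.

End schatten.

Section measurable_schatten.
Context d' (T : measurableType d') (R : realType) (d : nat).
Lemma measurable_schatten (p q : R) (F : T -> 'M[R[i]]_d) : measurable_mx F ->
  measurable_fun setT (fun x => schatten_norm p (F x) `^ q).
Proof.
move=> mF; apply: (measurableT_comp (measurable_powR q)).
apply: (measurableT_comp (measurable_powR p^-1)).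
apply: measurable_Re_tr; apply: measurable_mx_fun => [x||]; last exact: measurable_powR.
  exact: mx_fun_herm.
apply: measurable_mx_fun => [x||]; first exact: adj_mul_herm.
  by apply: measurable_mxM => //; exact: measurable_mx_adj.
by apply: continuous_measurable_fun; exact: sqrt_continuous.
Qed.
End measurable_schatten.

(** * Pulling a function of [Z] out of a conditional expectation under the trace *)

Section trace_pull_out.
Context d d' (T : measurableType d) (E : measurableType d') (R : realType).
Variables (P : probability T R) (Z : T -> E) (n : nat).
Hypothesis mZ : measurable_fun setT Z.
Local Notation itg f := (P.-integrable setT (EFin \o f)).

Lemma ler_norm_prod_ReIm (x y : R[i]) (b : R) : `|x| * `|y| <= b%:C ->
  `|complex.Re x * complex.Re y| <= b /\ `|complex.Im x * complex.Im y| <= b.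
Proof.
rewrite !normc_def -rmorphM lecR => h.
split; apply: le_trans h; rewrite normrM ler_pM // -sqrtr_sqr ler_wsqrtr //.
- by rewrite lerDl sqr_ge0.
- by rewrite lerDl sqr_ge0.
- by rewrite lerDr sqr_ge0.
- by rewrite lerDr sqr_ge0.
Qed.

(** The real part of the trace is a finite sum of products of real or imaginary parts of entries;
    [b] and [b'] make each product integrable, so the scalar rule applies term by term. The bound on
    [W] is almost sure since [W] is an arbitrary version. *)
Lemma trace_pull_out (Y W : T -> 'M[R[i]]_n) (G : E -> 'M[R[i]]_n) (b b' : T -> R) :
  is_cond_exp_mx P Z Y W -> measurable_mx G -> itg b -> itg b' ->
  (forall w i j k l, `|Y w i j| * `|G (Z w) k l| <= (b w)%:C) ->
  {ae P, forall w, forall i j k l, `|W w i j| * `|G (Z w) k l| <= (b' w)%:C} ->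
  [/\ itg (fun w => complex.Re (\tr (Y w *m G (Z w)))),
      itg (fun w => complex.Re (\tr (W w *m G (Z w)))) &
      \int[P]_w complex.Re (\tr (Y w *m G (Z w))) =
      \int[P]_w complex.Re (\tr (W w *m G (Z w)))].
Proof.
move=> YW mG ib ib' hb hb'.
have mYr i j : measurable_fun setT (fun w => complex.Re (Y w i j)).
  by have [[/integrableP[/measurable_EFinP]]] := YW i j.
have mYi i j : measurable_fun setT (fun w => complex.Im (Y w i j)).
  by have [_ [/integrableP[/measurable_EFinP]]] := YW i j.
have mGr i j : measurable_fun setT (fun w => complex.Re (G (Z w) i j)).
  by have [m _] := mG i j; exact: (measurableT_comp m).
have mGi i j : measurable_fun setT (fun w => complex.Im (G (Z w) i j)).
  by have [_ m] := mG i j; exact: (measurableT_comp m).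
have mWr i j : measurable_fun setT (fun w => complex.Re (W w i j)).
  by have [/cond_exp_measurable] := YW i j.
have mWi i j : measurable_fun setT (fun w => complex.Im (W w i j)).
  by have [_ /cond_exp_measurable] := YW i j.
have iYr i j : itg (fun w => complex.Re (Y w i j) * complex.Re (G (Z w) j i)).
  apply: (le_itg _ ib) => [|w]; first exact: measurable_funM.
  by have [] := ler_norm_prod_ReIm (hb w i j j i).
have iYi i j : itg (fun w => complex.Im (Y w i j) * complex.Im (G (Z w) j i)).
  apply: (le_itg _ ib) => [|w]; first exact: measurable_funM.
  by have [] := ler_norm_prod_ReIm (hb w i j j i).
have iWr i j : itg (fun w => complex.Re (W w i j) * complex.Re (G (Z w) j i)).
  apply: (ae_le_itg _ ib'); first exact: measurable_funM.
  by apply: filterS hb' => w hw; have [] := ler_norm_prod_ReIm (hw i j j i).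
have iWi i j : itg (fun w => complex.Im (W w i j) * complex.Im (G (Z w) j i)).
  apply: (ae_le_itg _ ib'); first exact: measurable_funM.
  by apply: filterS hb' => w hw; have [] := ler_norm_prod_ReIm (hw i j j i).
have iY i j : itg (fun w => complex.Re (Y w i j) * complex.Re (G (Z w) j i) -
    complex.Im (Y w i j) * complex.Im (G (Z w) j i)).
  by apply: ritgD => //; exact: ritgN.
have iW i j : itg (fun w => complex.Re (W w i j) * complex.Re (G (Z w) j i) -
    complex.Im (W w i j) * complex.Im (G (Z w) j i)).
  by apply: ritgD => //; exact: ritgN.
split.
- under eq_fun do rewrite Re_tr_mulmx.
  by apply: ritg_sum => i; apply: ritg_sum => j; exact: iY.
- under eq_fun do rewrite Re_tr_mulmx.
  by apply: ritg_sum => i; apply: ritg_sum => j; exact: iW.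
under eq_Rintegral do rewrite Re_tr_mulmx.
under [RHS]eq_Rintegral do rewrite Re_tr_mulmx.
rewrite Rintegral_sum => [|i]; last by apply: ritg_sum => j; exact: iY.
rewrite Rintegral_sum => [|i]; last by apply: ritg_sum => j; exact: iW.
apply: eq_bigr => i _.
rewrite Rintegral_sum => [|j]; last exact: iY.
rewrite Rintegral_sum => [|j]; last exact: iW.
apply: eq_bigr => j _; rewrite !RintegralB //.
have [hr hi] := YW i j; have [gr gi] := mG j i.
by rewrite (cond_exp_pull_out mZ hr gr) // (cond_exp_pull_out mZ hi gi).
Qed.

End trace_pull_out.

(** * The moment bound *)

Section moment_bound.
Context d d' (T : measurableType d) (E : measurableType d') (R : realType).
Variables (P : probability T R) (Z Z' : T -> E) (n : nat).
Hypotheses (mZ : measurable_fun setT Z) (mZ' : measurable_fun setT Z').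
Hypothesis ZZ' : exchangeable P Z Z'.
Variable Psi : E -> 'M[R[i]]_n.
Hypotheses (hPsi : forall z, Psi z \is hermsymmx) (mPsi : measurable_mx Psi).
Variables (alpha : R) (W1 W2 : T -> 'M[R[i]]_n).
Hypothesis alpha0 : 0 < alpha.
Let dif w := Psi (Z w) - Psi (Z' w).
Hypothesis W1E : is_cond_exp_mx P Z dif W1.
Hypothesis W1X : {ae P, forall w, W1 w = alpha%:C *: Psi (Z w)}.
Hypothesis W2E : is_cond_exp_mx P Z (fun w => dif w *m dif w) W2.
Variable p : R.
Hypothesis hp : p = 1 \/ 3 / 2 <= p.
Local Notation itg f := (P.-integrable setT (EFin \o f)).
Local Notation s := (2 * p - 1).
Let N z := schatten_norm (2 * p) (Psi z).
Let Delta w := ((2 * alpha)^-1)%:C *: W2 w.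
Hypothesis iN : itg (fun w => N (Z w) `^ (2 * p)).
Hypothesis iD : itg (fun w => schatten_norm p (Delta w) `^ p).

Let F A : 'M[R[i]]_n := mx_fun (spow s) A.
Let G A : 'M[R[i]]_n := mx_fun (fun x => `|x| `^ (s - 1)) A.

Local Opaque schatten_norm mx_fun.

Let p1 : 1 <= p. Proof. by case: hp => [->//|]; lra. Qed.
Let r0 : 0 < 2 * p. Proof. by have := p1; lra. Qed.
Let s0 : 0 < s. Proof. by have := p1; lra. Qed.
Let s1 : 0 <= s - 1. Proof. by have := p1; lra. Qed.
Let s12 : s = 1 \/ 2 <= s. Proof. by case: hp => [->|h]; [left; ring|right; lra]. Qed.
(** Degree count: X - X' contributes 1 and F contributes s, while the square of X - X' contributes 2
    and G contributes s - 1. *)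
Let r_s1 : s + 1 = 2 * p. Proof. by ring. Qed.
Let r_s2 : 2 + (s - 1) = 2 * p. Proof. by ring. Qed.
Let N0 z : 0 <= N z. Proof. exact: schatten_norm_ge0. Qed.

Let mG : measurable_mx (fun z => G (Psi z)).
Proof.
apply: measurable_mx_fun => //; apply: (measurableT_comp (measurable_powR _)).
exact: normr_measurable.
Qed.

Let mF : measurable_mx (fun z => F (Psi z)).
Proof. by apply: measurable_mx_fun => //; exact: measurable_spow. Qed.

Let mN : measurable_fun setT (fun z => N z `^ (2 * p)).
Proof. exact: measurable_schatten. Qed.

Let iN' : itg (fun w => N (Z' w) `^ (2 * p)).
Proof.
have mN1 : measurable_fun setT (fun x : E * E => N x.1 `^ (2 * p)).
  exact: (measurableT_comp mN measurable_fst).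
exact: (exchangeable_integrable mZ mZ' ZZ' mN1 iN).
Qed.

(** One majorant for the norms of both X and X', whose 2p-th moment is finite by exchangeability. *)
Let S w := N (Z w) + N (Z' w).
Let S0 w : 0 <= S w. Proof. by rewrite addr_ge0. Qed.

Let N_le_S w : N (Z w) <= S w. Proof. by rewrite lerDl. Qed.

Let iS : itg (fun w => S w `^ (2 * p)).
Proof.
apply: (@le_itg _ _ _ P _ (fun w => 2 `^ (2 * p) * (N (Z w) `^ (2 * p) + N (Z' w) `^ (2 * p)))).
- apply: (measurableT_comp (measurable_powR _)).
  have mN1 : measurable_fun setT N.
    have := @measurable_schatten _ E R n (2 * p) 1 Psi mPsi.
    by under eq_fun do rewrite (powRr1 (schatten_norm_ge0 _ _)).
  by apply: measurable_funD; exact: measurableT_comp.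
- exact: (ritgZ (2 `^ (2 * p)) (ritgD iN iN')).
- by move=> w; rewrite ger0_norm ?powR_ge0 // powR_addl_le // ltW.
Qed.

Let dif_le w i j : `|dif w i j| <= (S w *+ n)%:C.
Proof.
rewrite /dif 2!mxE mulrnDl rmorphD (le_trans (ler_normB _ _)) // lerD //.
  exact: herm_entry_le.
exact: herm_entry_le.
Qed.

Let dif2_le w i j : `|(dif w *m dif w) i j| <= ((S w *+ n) ^+ 2 *+ n)%:C.
Proof.
rewrite mxE (le_trans (ler_norm_sum _ _ _)) //.
rewrite rmorphMn /= -[X in _ <= _ *+ X]card_ord -sumr_const ler_sum // => k _.
by rewrite normrM expr2 rmorphM ler_pM // dif_le.
Qed.

Let F_le w i j : `|F (Psi (Z w)) i j| <= (S w `^ s *+ n)%:C.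
Proof.
apply: (@le_trans _ _ (N (Z w) `^ s *+ n)%:C).
  by apply: mx_fun_powR_entry_le; rewrite ?ltW // => x; rewrite normr_spow.
by rewrite lecR lerMn2r (ge0_ler_powR (ltW s0)) ?nnegrE ?orbT.
Qed.

Let G_leN w i j : `|G (Psi (Z w)) i j| <= (N (Z w) `^ (s - 1) *+ n)%:C.
Proof.
apply: mx_fun_powR_entry_le => // x; rewrite ger0_norm ?powR_ge0 //.
Qed.

Let G_le w i j : `|G (Psi (Z w)) i j| <= (S w `^ (s - 1) *+ n)%:C.
Proof.
apply: (le_trans (G_leN w i j)).
by rewrite lecR lerMn2r (ge0_ler_powR s1) ?nnegrE ?orbT.
Qed.

(** Written on pairs so that exchanging [Z] and [Z'] becomes swapping the argument. *)
Let phi1 x : R := complex.Re (\tr ((Psi x.1 - Psi x.2) *m F (Psi x.1))).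
Let phi2 x : R :=
  complex.Re (\tr ((Psi x.1 - Psi x.2) *m (Psi x.1 - Psi x.2) *m G (Psi x.1))).

Let measurable_mx_comp k (U : measurableType k) (f : U -> E) (H : E -> 'M[R[i]]_n) :
  measurable_fun setT f -> measurable_mx H -> measurable_mx (fun x => H (f x)).
Proof.
by move=> mf mH i j; have [hr hi] := mH i j; split;
  [exact: (measurableT_comp hr)|exact: (measurableT_comp hi)].
Qed.

Let mdif : measurable_mx (fun x : E * E => Psi x.1 - Psi x.2).
Proof.
apply: measurable_mxD; first exact: measurable_mx_comp.
by apply: measurable_mxN; exact: measurable_mx_comp.
Qed.

Let mphi1 : measurable_fun setT phi1.
Proof.
apply: measurable_Re_tr; apply: measurable_mxM => //.
exact: (@measurable_mx_comp _ _ fst (fun z => F (Psi z))).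
Qed.

Let mphi2 : measurable_fun setT phi2.
Proof.
apply: measurable_Re_tr; apply: measurable_mxM; first exact: measurable_mxM.
exact: (@measurable_mx_comp _ _ fst (fun z => G (Psi z))).
Qed.

(** Once F(X) is pulled out, the Stein identity replaces X - X' by alpha X, and the trace of X F(X)
    is the 2p-th power of the norm. *)
Let trace_F : itg (fun w => phi1 (Z w, Z' w)) /\
  \int[P]_w phi1 (Z w, Z' w) = alpha * \int[P]_w N (Z w) `^ (2 * p).
Proof.
have [||||i1 i2 e12] := @trace_pull_out _ _ T E R P Z n mZ dif W1 (fun z => F (Psi z))
  (fun w => n%:R * n%:R * S w `^ (2 * p))
  (fun w => alpha * n%:R * n%:R * N (Z w) `^ (2 * p)) W1E mF.
- exact: (ritgZ (n%:R * n%:R) iS).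
- exact: (ritgZ (alpha * n%:R * n%:R) iN).
- move=> w i j k l; apply: (le_trans (ler_pM _ _ (dif_le w i j) (F_le w k l))) => //.
  rewrite -rmorphM lecR -[S w *+ n]mulr_natl -[_ `^ s *+ n]mulr_natl mulrACA.
  by rewrite mulr_powRB1.
- apply: filterS W1X => w -> i j k l.
  rewrite mxE normrM (ger0_norm (_ : 0 <= alpha%:C)) ?ler0c ?(ltW alpha0) //.
  rewrite -[leLHS]mulrA.
  have -> : (alpha * n%:R * n%:R * N (Z w) `^ (2 * p))%:C =
      alpha%:C * (n%:R * n%:R * N (Z w) `^ (2 * p))%:C.
    by rewrite -rmorphM -!mulrA.
  rewrite ler_wpM2l ?ler0c ?(ltW alpha0) //.
  have hX := herm_entry_le i j (hPsi (Z w)) r0.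
  have hF : `|F (Psi (Z w)) k l| <= (N (Z w) `^ s *+ n)%:C.
    by apply: mx_fun_powR_entry_le; rewrite ?ltW // => x; rewrite normr_spow.
  apply: (le_trans (ler_pM _ _ hX hF)) => //.
  rewrite -rmorphM lecR -/(N (Z w)) -[N _ *+ n]mulr_natl -[_ `^ s *+ n]mulr_natl mulrACA.
  by rewrite mulr_powRB1 // mulrA.
split; first exact: i1.
apply: (etrans e12); transitivity (\int[P]_w (alpha * N (Z w) `^ (2 * p))); last first.
  exact: (RintegralZl _ measurableT iN).
apply: (ae_eq_Rintegral i2 (ritgZ alpha iN)).
apply: filterS W1X => w ->.
by rewrite -scalemxAl mxtraceZ Re_real_mul /F (tr_mul_spow (hPsi (Z w)) s0) r_s1.
Qed.

Let K w := schatten_norm p (Delta w).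

Let W2Delta w : W2 w = (2 * alpha)%:C *: Delta w.
Proof.
rewrite scalerA -rmorphM mulfV ?scale1r // gt_eqF // mulr_gt0 //.
Qed.

(** The square of the Hermitian X - X' is Hermitian, hence so is almost every value of any version
    of its conditional expectation. The eigenvalue formulas for the norm of Delta rest on this. *)
Let hDelta : {ae P, forall w, Delta w \is hermsymmx}.
Proof.
have hdif w : dif w \is hermsymmx by exact: hermsymmxB.
have h2 w : dif w *m dif w \is hermsymmx.
  by have := adj_mul_herm (dif w); rewrite (hermsymmxP _ (hdif w)).
apply: filterS (cond_exp_mx_herm mZ W2E h2) => w /hermsymmxP hW.
apply/hermsymmxP/matrixP => i j; have /matrixP/(_ i j) := hW.
by rewrite !mxE => <-; rewrite rmorphM /= conj_real.
Qed.

Let trace_G : [/\ itg (fun w => phi2 (Z w, Z' w)),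
  itg (fun w => complex.Re (\tr (W2 w *m G (Psi (Z w))))) &
  \int[P]_w phi2 (Z w, Z' w) = \int[P]_w complex.Re (\tr (W2 w *m G (Psi (Z w))))].
Proof.
apply: (@trace_pull_out _ _ T E R P Z n mZ _ W2 (fun z => G (Psi z))
  (* Three of the factors [n] come from an entry of the square of X - X', the fourth from an entry
     of G(X). *)
  (fun w => (n%:R * n%:R * n%:R * n%:R) * S w `^ (2 * p))
  (fun w => (2 * alpha * n%:R * n%:R) * (K w `^ p + N (Z w) `^ (2 * p))) W2E mG).
- exact: (ritgZ _ iS).
- exact: (ritgZ _ (ritgD iD iN)).
- move=> w i j k l; apply: (le_trans (ler_pM _ _ (dif2_le w i j) (G_le w k l))) => //.
  rewrite -rmorphM lecR -[S w *+ n]mulr_natl -[_ ^+ 2 *+ n]mulr_natl.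
  rewrite -[_ `^ (s - 1) *+ n]mulr_natl.
  have <- : S w ^+ 2 * S w `^ (s - 1) = S w `^ (2 * p).
    by rewrite -powR_mulrn // -powRD r_s2 // gt_eqF.
  by rewrite le_eqVlt; apply/orP; left; apply/eqP; ring.
- apply: filterS hDelta => w hD i j k l; rewrite W2Delta mxE normrM.
  have a0 : 0 <= 2 * alpha by rewrite mulr_ge0 // ltW.
  rewrite (ger0_norm (_ : 0 <= (2 * alpha)%:C)) ?ler0c // -[leLHS]mulrA.
  have hd := herm_entry_le i j hD (lt_le_trans ltr01 p1).
  have h := ler_pM (normr_ge0 _) (normr_ge0 _) hd (G_leN w k l).
  apply: (le_trans (ler_wpM2l _ h)); first by rewrite ler0c.
  rewrite -2!rmorphM lecR -/(K w) -[K w *+ n]mulr_natl -[_ `^ (s - 1) *+ n]mulr_natl.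
  have y : K w * N (Z w) `^ (s - 1) <= K w `^ p + N (Z w) `^ (2 * p).
    by apply: mul_powR_le_add; rewrite ?schatten_norm_ge0.
  have -> : 2 * alpha * (n%:R * K w * (n%:R * N (Z w) `^ (s - 1))) =
    2 * alpha * n%:R * n%:R * (K w * N (Z w) `^ (s - 1)) by ring.
  have c0 : 0 <= 2 * alpha * n%:R * n%:R :> R by rewrite 2?(mulr_ge0, ler0n).
  exact: (ler_wpM2l c0 y).
Qed.

Lemma stein_moment_le : \int[P]_w N (Z w) `^ (2 * p) <= s `^ p * \int[P]_w K w `^ p.
Proof.
have [i1 e1] := trace_F; have [i2 i3 e2] := trace_G.
have i1' := exchangeable_integrable mZ mZ' ZZ' mphi1 i1.
have i2' := exchangeable_integrable mZ mZ' ZZ' mphi2 i2.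
have e1' := exchangeable_Rintegral mZ mZ' ZZ' mphi1.
have e2' := exchangeable_Rintegral mZ mZ' ZZ' mphi2.
have phi12 z z' : phi1 (z, z') + phi1 (z', z) <= s / 2 * (phi2 (z, z') + phi2 (z', z)).
  apply: le_trans (mean_value_trace (hPsi z) (hPsi z') (fun a b => spow_mean_value a b s12)).
  by rewrite tr_mulBB_split cReD.
have phi2_le : {ae P, forall w, s * complex.Re (\tr (W2 w *m G (Psi (Z w)))) <=
    2 * alpha * (s `^ p / p * K w `^ p + (1 - p^-1) * N (Z w) `^ (2 * p))}.
  apply: filterS hDelta => w hD; rewrite W2Delta -scalemxAl mxtraceZ Re_real_mul.
  have a0 : 0 <= 2 * alpha by exact: (mulr_ge0 _ (ltW alpha0)).
  rewrite [leLHS]mulrCA; exact: (ler_wpM2l a0 (schatten_young p1 hD (hPsi (Z w)))).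
pose M := \int[P]_w N (Z w) `^ (2 * p); pose D := \int[P]_w K w `^ p.
have {}e1 : \int[P]_w phi1 (Z w, Z' w) = alpha * M := e1.
suff h : M <= s `^ p * D by exact: h.
have i11 := ritgD i1 i1'; have i22 := ritgZ (s / 2) (ritgD i2 i2').
have h1 := le_Rintegral measurableT i11 i22 (fun w _ => phi12 (Z w) (Z' w)).
have q1 := RintegralD measurableT i1 i1'.
have q2 := RintegralZl (s / 2) measurableT (ritgD i2 i2').
have q3 := RintegralD measurableT i2 i2'.
have {}h1 := ler_subst h1 q1 (etrans q2 (congr1 ( *%R (s / 2)) q3)).
(* This is 2 alpha M <= s E phi2. *)
have {}h1 := symmetrized_le e1 e1' e2' h1.
have iK := ritgZ (s `^ p / p) iD; have iM := ritgZ (1 - p^-1) iN.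
have h2 := ae_le_Rintegral (ritgZ s i3) (ritgZ (2 * alpha) (ritgD iK iM)) phi2_le.
have {}q1 := RintegralZl s measurableT i3.
have {}q2 := RintegralZl (2 * alpha) measurableT (ritgD iK iM).
have {}q3 := RintegralD measurableT iK iM.
have q4 := RintegralZl (s `^ p / p) measurableT iD.
have q5 := RintegralZl (1 - p^-1) measurableT iN.
have {}h2 := ler_subst h2 (etrans q1 (congr1 ( *%R s) (esym e2)))
  (etrans q2 (congr1 ( *%R (2 * alpha)) (etrans q3 (f_equal2 +%R q4 q5)))).
have {h1 h2} h := le_trans h1 h2.
(* Both sides carry the factor 2 alpha; cancelling it makes the scale factor disappear from the
   bound. *)
apply: (absorb_fraction p1); have a2 : 0 < 2 * alpha by rewrite mulr_gt0.
by rewrite -(ler_pM2l a2) -[leLHS]mulrA; exact: h.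
Qed.

End moment_bound.

(** * Roots of moments and the case of an infinite moment *)

Lemma integrable_of_expectation d (T : measurableType d) (R : realType)
    (P : probability T R) (f : T -> R) :
  measurable_fun setT f -> (forall w, 0 <= f w) -> ('E_P[f] < +oo)%E ->
  P.-integrable setT (EFin \o f) /\ 'E_P[f]%E = (\int[P]_w f w)%:E.
Proof.
move=> mf f0; rewrite unlock => foo.
have fi : P.-integrable setT (EFin \o f).
  apply/integrableP; split; first exact/measurable_EFinP.
  by under eq_integral do rewrite /= ger0_norm //.
by split => //; rewrite /Rintegral fineK //; exact: integrable_fin_num.
Qed.

(** The 2p-th root of s^p is the square root of s, as p / (2p) = 1/2. *)
Lemma powR_root_le (R : realType) (p s x y : R) : 0 < p -> 0 <= s -> 0 <= x -> 0 <= y ->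
  y <= s `^ p * x -> y `^ (2 * p)^-1 <= Num.sqrt s * x `^ (2 * p)^-1.
Proof.
move=> p0 s0 x0 y0 yx; have r0 : 0 <= (2 * p)^-1 by rewrite invr_ge0 mulr_ge0 // ltW.
rewrite -powR12_sqrt // (_ : 2^-1 = p * (2 * p)^-1); last by field; rewrite gt_eqF.
rewrite powRrM -powRM ?powR_ge0 // ge0_ler_powR // nnegrE ?mulr_ge0 ?powR_ge0 //.
Qed.

(** If x = +oo, the right-hand side is +oo because the square root of s is positive; the real
    estimate is demanded only for finite x. *)
Lemma poweR_root_le (R : realType) (p s : R) (x y : \bar R) (r : R) :
  0 < p -> 0 < s -> 0 <= r -> y = r%:E ->
  ((x < +oo)%E -> exists t, [/\ x = t%:E, 0 <= t & r <= s `^ p * t]) ->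
  (y `^ (2 * p)^-1 <= (Num.sqrt s)%:E * x `^ (2 * p)^-1)%E.
Proof.
move=> p0 s0 r0 -> xt; have [/xt[t [-> t0 rt]]|] := ltP x +oo%E.
  by rewrite !poweR_EFin -EFinM lee_fin powR_root_le // ltW.
rewrite leye_eq => /eqP ->; rewrite poweRyr ?invr_neq0 ?gt_eqF ?mulr_gt0 //.
by rewrite mulry gtr0_sg ?sqrtr_gt0 // mul1e leey.
Qed.

Theorem theorem7p1 (R : realType) (disp : measure_display)
    (Omega : measurableType disp) (P : probability Omega R)
    (S : ptopologicalType) (hS : polish R S)
    (d : nat) (Z Z' : Omega -> borel S) (Psi : borel S -> 'M[R[i]%C]_d)
    (alpha : R) (Delta : Omega -> 'M[R[i]%C]_d) (p : R)
    (hp : p = 1 \/ 3 / 2 <= p)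
    (hX : matrix_stein_pair P Z Z' Psi alpha)
    (hDelta : is_cond_variance P Z Z' Psi alpha Delta)
    (hmom : ('E_P[fun w => (schatten_norm (2 * p) (Psi (Z w)) `^ (2 * p))%R]
             < +oo)%E) :
  ('E_P[fun w => (schatten_norm (2 * p) (Psi (Z w)) `^ (2 * p))%R]
     `^ (2 * p)^-1
   <= (Num.sqrt (2 * p - 1))%:E *
      'E_P[fun w => (schatten_norm p (Delta w) `^ p)%R] `^ (2 * p)^-1)%E.
Proof.
have p1 : 1 <= p by case: hp => [->//|]; lra.
have p0 : 0 < p := lt_le_trans ltr01 p1.
have s0 : 0 < 2 * p - 1 by lra.
case: hX => -[mZ mZ'] ZZ' hPsi mPsi /andP[alpha0 _] [W1 W1E W1X] _.
case: hDelta => W2 W2E /funext DeltaE.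
have mDelta : measurable_fun setT (fun w => schatten_norm p (Delta w) `^ p).
  rewrite DeltaE; apply/measurable_schatten/measurable_mxZ => i j.
  by have [/cond_exp_measurable ? /cond_exp_measurable ?] := W2E i j.
have mN : measurable_fun setT (fun w => schatten_norm (2 * p) (Psi (Z w)) `^ (2 * p)).
  exact: (measurableT_comp (measurable_schatten _ _ mPsi)).
have [iN eN] := integrable_of_expectation mN (fun w => powR_ge0 _ _) hmom.
apply: (poweR_root_le p0 s0 _ eN).
  by apply: Rintegral_ge0 => w _; exact: powR_ge0.
move=> Doo.
have [iD eD] := integrable_of_expectation mDelta (fun w => powR_ge0 _ _) Doo.
exists (\int[P]_w (schatten_norm p (Delta w) `^ p))%R; split; first exact: eD.
  by apply: Rintegral_ge0 => w _; exact: powR_ge0.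
rewrite DeltaE in iD *.
exact: (stein_moment_le mZ mZ' ZZ' hPsi mPsi alpha0 W1E W1X W2E hp iN iD).
Qed.
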